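(* Let $0<\alpha<1$ and let $f(z)=\sum_{n=0}^\infty a_n z^n$ be a Bloch function on $\mathbb{D}$ with $\|f\|_{\mathbf{B}}\le 1$. Then $$\sum_{n=0}^\infty \frac{\Gamma(n+1)}{\Gamma(n+1-\alpha)}\,|a_n|\, r^{n-\alpha} \;\le\; \frac{r^{-\alpha}}{\Gamma(1-\alpha)}\qquad\text{for all } 0<r\le M(\alpha),$$ where $M(\alpha)$ is the minimum positive root $r\in(0,1)$ of $$\big({}_2F_1(1,1;2-\alpha;r)\big)\,\big({}_2F_1(2,1;2-\alpha;r)\big) = \frac{(1-\alpha)^2}{r^2}.$$
   Context: $\mathbb{D}=\{z\in\mathbb{C}:|z|<1\}$. An analytic function $f$ on $\mathbb{D}$ is a Bloch function if $\sup_{z\in\mathbb{D}}|f'(z)|(1-|z|^2)<\infty$; the space $\mathbf{B}$ of Bloch functions carries the norm $\|f\|_{\mathbf{B}}=|f(0)|+\sup_{z\in\mathbb{D}}|f'(z)|(1-|z|^2)$. $\Gamma$ is the Gamma function, and ${}_2F_1(a,b;c;x)=\sum_{n=0}^\infty\frac{(a)_n(b)_n}{(c)_n}\frac{x^n}{n!}$ is the Gauss hypergeometric function, where $(q)_n=q(q+1)\cdots(q+n-1)$, $(q)_0=1$. The left-hand side of the inequality is the majorant series (Bohr sum) of the Riemann–Liouville fractional derivative $D^\alpha f(z)=\sum_{n=0}^\infty a_n\frac{\Gamma(n+1)}{\Gamma(n+1-\alpha)}z^{n-\alpha}$, with $r=|z|$. *)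

(* Defs.v *)
From Stdlib Require Import Reals Factorial.
From Coquelicot Require Import Coquelicot.
Open Scope R_scope.

(** Functions on the disc are represented by total functions [C -> C], of
    which only the values on [unit_disc] are used. *)
Definition unit_disc (z : C) : Prop := Cmod z < 1.

Definition analytic_on_disc (f : C -> C) : Prop :=
  forall z : C, unit_disc z -> ex_derive (K := C_AbsRing) f z.

(** The supremum is taken in [Rbar], so it is [p_infty] exactly when the set is
    unbounded. *)
Definition Bloch_seminorm (f : C -> C) : Rbar :=
  Lub_Rbar (fun y : R => exists z : C,
    unit_disc z /\ y = Cmod (C_derive f z) * (1 - Cmod z ^ 2)).

Definition is_Bloch (f : C -> C) : Prop :=
  analytic_on_disc f /\ Rbar_lt (Bloch_seminorm f) p_infty.

Definition Bloch_norm (f : C -> C) : Rbar :=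
  Rbar_plus (Finite (Cmod (f (RtoC 0)))) (Bloch_seminorm f).

(** Euler's integral, improper at both ends; meaningful for [0 < x]. *)
Definition Gamma (x : R) : R :=
  RInt_gen (fun t : R => Rpower t (x - 1) * exp (- t))
    (at_right 0) (Rbar_locally p_infty).

Fixpoint pochhammer (q : R) (n : nat) : R :=
  match n with
  | O => 1
  | S m => pochhammer q m * (q + INR m)
  end.

(** [PSeries] is total; the series converges for [Rabs x < 1] as soon as [c]
    is not a nonpositive integer. *)
Definition hyp2F1 (a b c x : R) : R :=
  PSeries (fun n : nat =>
    pochhammer a n * pochhammer b n / pochhammer c n / INR (fact n)) x.

Definition radius_equation (alpha r : R) : Prop :=
  hyp2F1 1 1 (2 - alpha) r * hyp2F1 2 1 (2 - alpha) r
  = (1 - alpha) ^ 2 / r ^ 2.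

Definition is_min_radius (alpha M : R) : Prop :=
  (0 < M < 1 /\ radius_equation alpha M) /\
  forall s : R, 0 < s < 1 -> radius_equation alpha s -> M <= s.

(** The general term of the majorant series of the fractional derivative
    [D^alpha f], where [f] has Taylor coefficients [a]. [Rpower] is the real
    power, as the exponent [n - alpha] is not an integer. *)
Definition frac_bohr_term (alpha : R) (a : nat -> C) (r : R) (n : nat) : R :=
  Gamma (INR n + 1) / Gamma (INR n + 1 - alpha) * Cmod (a n)
  * Rpower r (INR n - alpha).

(* Main.v *)
Require Import Defs.
From Stdlib Require Import Reals.
From Coquelicot Require Import Coquelicot.
From Stdlib Require Import Factorial Ranalysis5 Lra Lia.
Open Scope R_scope.

(** Put [b = 1 - alpha], [b_k = (k+1) a_(k+1)], the coefficients of [f'], and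
    [m = 1 - |a_0|], so that [|f'(z)| (1 - |z|^2) <= m].  Averaging [|f'|^2] over
    a circle gives [sum |b_k|^2 t^k <= m^2 / (1-t)^2 = m^2 sum (k+1) t^k] for
    [0 <= t < 1].  The numbers [e_k = k! / (b)_(k+1)] are the moments of
    [(1-u)^(b-1)] on [[0,1]]; taking [t = r u] and integrating against this
    weight yields [sum e_k |b_k|^2 r^k <= m^2 sum (k+1) e_k r^k].  Up to the
    common factor [r^(-alpha) / Gamma(1-alpha)], the terms of index [n = k+1] of
    the Bohr sum are [e_k |b_k| r^(k+1)], so Cauchy-Schwarz bounds
    their sum by [m r sqrt ((sum e_k r^k) (sum (k+1) e_k r^k))], which is
    [m r sqrt (F1 F2) / b] for the two hypergeometric functions [F1], [F2].
    This is at most [m] exactly when [r^2 F1 F2 <= b^2], and the left-hand side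
    increases with [r]. *)

(** The bound on [f'] controls whole sums at each [t], never single coefficients, so the comparison
    of the two power series survives only under functionals that are positive in [t]. This is why
    the weights [e_k] have to be recognised as moments of a positive weight. The number
    [m = 1 - |a_0|] is what the norm condition leaves to the derivative, and also exactly the room
    that the term of index 0 leaves in the Bohr sum, so the two occurrences of [|a_0|] cancel.
    Neither averaging step forms an integral: the circle mean becomes a mean over [N + 1] roots of
    unity, exact for polynomials of degree at most [N], and the beta integral, singular at [u = 1]
    because [b < 1], is handled through primitives. Both devices act on polynomials, so each
    estimate is made for partial sums with an explicit error that is then sent to zero. *)

Ltac eq_at T := match goal with |- @eq _ ?x ?y => change (@eq T x y) end.

(** * The Gamma function *)

Notation gamma_kernel x := (fun t : R => Rpower t (x - 1) * exp (- t)).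
Notation is_gamma x l := (is_RInt_gen (gamma_kernel x) (at_right 0) (Rbar_locally p_infty) l).

Lemma is_derive_Rpower (p t : R) :
  0 < t -> is_derive (fun u : R => Rpower u p) t (p * Rpower t (p - 1)).
Proof.
intros Ht.
apply is_derive_Reals.
now apply derivable_pt_lim_power.
Qed.

(** The limit is the supremum of the integrals over compact subintervals. By positivity these grow
    with the interval, so one interval within [eps] of the supremum controls all larger ones, at
    both ends at once. *)
Lemma is_RInt_gen_bounded (g : R -> R) (B : R) :
  (forall t, 0 < t -> continuous g t) ->
  (forall t, 0 < t -> 0 < g t) ->
  (forall a b, 0 < a -> a < b -> RInt g a b <= B) ->
  exists l, 0 < l /\ is_RInt_gen g (at_right 0) (Rbar_locally p_infty) l.
Proof.
intros Hc Hp HB.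
assert (Hex : forall a b, 0 < a -> a <= b -> ex_RInt g a b).
{ intros a b Ha Hab. apply (ex_RInt_continuous (V := R_CompleteNormedModule)).
  intros z Hz. apply Hc. rewrite Rmin_left in Hz by lra. lra. }
assert (Hmono : forall a b c d, 0 < a -> a <= b -> b < c -> c <= d ->
  RInt g b c <= RInt g a d).
{ intros a b c d Ha Hab Hbc Hcd.
  assert (H0 : forall u v, 0 < u -> u <= v -> 0 <= RInt g u v).
  { intros u v Hu Huv. apply RInt_ge_0; [assumption | now apply Hex |].
    intros t Ht. left. apply Hp. lra. }
  rewrite <- (RInt_Chasles g a b d) by (apply Hex; lra).
  rewrite <- (RInt_Chasles g b c d) by (apply Hex; lra).
  unfold plus; simpl.
  generalize (H0 a b Ha Hab) (H0 c d ltac:(lra) Hcd). lra. }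
set (E := fun y => exists a b, 0 < a < b /\ y = RInt g a b).
destruct (completeness E) as [l [Hub Hlub]].
{ exists B. intros y [a [b [Hab ->]]]. apply HB; lra. }
{ exists (RInt g 1 2), 1, 2. split; [lra | reflexivity]. }
exists l; split.
{ apply Rlt_le_trans with (RInt g 1 2).
  - apply RInt_gt_0; [lra | intros t Ht; apply Hp; lra | intros t Ht; apply Hc; lra].
  - apply Hub. exists 1, 2. split; [lra | reflexivity]. }
intros P [eps HP].
assert (Hnear : exists a b, 0 < a < b /\ l - eps < RInt g a b).
{ apply Classical_Prop.NNPP. intros Hn.
  assert (l <= l - eps); [| destruct eps; simpl in *; lra].
  apply Hlub. intros y [a [b [Hab ->]]].
  apply Rnot_lt_le. intros Hlt. apply Hn. now exists a, b. }
destruct Hnear as [a [b [Hab Hl]]].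
apply (Filter_prod _ _ _ (fun u => 0 < u < a) (fun v => b < v)).
- exists (mkposreal a (proj1 Hab)). intros u Hu Hu0.
  change (Rabs (u - 0) < a) in Hu.
  apply Rabs_def2 in Hu. lra.
- exists b. auto.
- intros u v Hu Hv. exists (RInt g u v). split.
  + apply (RInt_correct (V := R_CompleteNormedModule) g u v), Hex; lra.
  + apply HP. change (Rabs (RInt g u v - l) < eps).
    assert (RInt g u v <= l) by (apply Hub; exists u, v; split; [lra | reflexivity]).
    assert (RInt g a b <= RInt g u v) by (apply Hmono; lra).
    apply Rabs_def1; destruct eps; simpl in *; lra.
Qed.

Lemma gamma_kernel_continuous (x t : R) : 0 < t -> continuous (gamma_kernel x) t.
Proof.
intros Ht.
apply (ex_derive_continuous (K := R_AbsRing) (V := R_NormedModule)).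
apply (ex_derive_mult (fun u => Rpower u (x - 1)) (fun u => exp (- u))).
- eexists. now apply is_derive_Rpower.
- auto_derive. easy.
Qed.

(** Below 1 the kernel is at most [t^(x-1)], with integral at most [1/x]; above 1 it is at most
    [exp (-t)], because [x <= 1]. The range contains the base points [1] and [1 - alpha], from which
    the functional equation reaches all other arguments. *)
Lemma ex_gamma_unit (x : R) : 0 < x <= 1 -> exists l, 0 < l /\ is_gamma x l.
Proof.
intros Hx.
apply is_RInt_gen_bounded with (B := / x + 1).
- intros t. apply gamma_kernel_continuous.
- intros t _. apply Rmult_lt_0_compat; apply exp_pos.
- intros a b Ha Hab.
  assert (Hex : forall u v, 0 < u -> u <= v -> ex_RInt (gamma_kernel x) u v).
  { intros u v Hu Huv. apply (ex_RInt_continuous (V := R_CompleteNormedModule)).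
    intros z Hz. apply gamma_kernel_continuous. rewrite Rmin_left in Hz by lra. lra. }
  assert (H0 : forall u v, 0 < u -> u <= v -> 0 <= RInt (gamma_kernel x) u v).
  { intros u v Hu Huv. apply RInt_ge_0; [assumption | now apply Hex |].
    intros t Ht. left. apply Rmult_lt_0_compat; apply exp_pos. }
  assert (Hsmall : forall u, 0 < u <= 1 -> RInt (gamma_kernel x) u 1 <= / x).
  { intros u Hu.
    assert (Hi : is_RInt (fun t => Rpower t (x - 1)) u 1
                   (Rpower 1 x / x - Rpower u x / x)).
    { apply (is_RInt_derive (fun t => Rpower t x / x)).
      - intros t Ht. rewrite Rmin_left in Ht by lra.
        replace (Rpower t (x - 1)) with (x * Rpower t (x - 1) * / x) by (field; lra).
        apply (is_derive_scal_l (fun t => Rpower t x) t (x * Rpower t (x - 1)) (/ x)).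
        apply is_derive_Rpower. lra.
      - intros t Ht. rewrite Rmin_left in Ht by lra.
        apply (ex_derive_continuous (K := R_AbsRing) (V := R_NormedModule)).
        eexists. apply is_derive_Rpower. lra. }
    apply Rle_trans with (Rpower 1 x / x - Rpower u x / x).
    - rewrite <- (is_RInt_unique _ _ _ _ Hi).
      apply RInt_le; [lra | apply Hex; lra | now eexists; apply Hi |].
      intros t Ht. rewrite <- (Rmult_1_r (Rpower t (x - 1))) at 2.
      apply Rmult_le_compat_l; [left; apply exp_pos |].
      rewrite <- exp_0. left. apply exp_increasing. lra.
    - assert (Rpower 1 x = 1) as -> by (unfold Rpower; rewrite ln_1, Rmult_0_r; apply exp_0).
      assert (0 < Rpower u x / x) by (apply Rdiv_lt_0_compat; [apply exp_pos | lra]).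
      lra. }
  assert (Hbig : forall v, 1 <= v -> RInt (gamma_kernel x) 1 v <= 1).
  { intros v Hv.
    assert (Hi : is_RInt (fun t => exp (- t)) 1 v (- exp (- v) - - exp (- 1))).
    { apply (is_RInt_derive (fun t => - exp (- t))).
      - intros t _. auto_derive; [easy | ring].
      - intros t _. apply (ex_derive_continuous (K := R_AbsRing) (V := R_NormedModule)).
        auto_derive. easy. }
    apply Rle_trans with (- exp (- v) - - exp (- 1)).
    - rewrite <- (is_RInt_unique _ _ _ _ Hi).
      apply RInt_le; [lra | apply Hex; lra | now eexists; apply Hi |].
      intros t Ht. rewrite <- (Rmult_1_l (exp (- t))) at 2.
      apply Rmult_le_compat_r; [left; apply exp_pos |].
      apply Rle_trans with (exp 0); [unfold Rpower | rewrite exp_0; lra].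
      assert (Hln : 0 < ln t) by (rewrite <- ln_1; apply ln_increasing; lra).
      destruct (Req_dec x 1) as [-> | Hx1].
      + right. f_equal. ring.
      + left. apply exp_increasing. nra.
    - assert (exp (- 1) < exp 0) by (apply exp_increasing; lra).
      rewrite exp_0 in *. generalize (exp_pos (- v)). lra. }
  (* The interval is enlarged to contain 1, so that it can be split there. *)
  apply Rle_trans with (RInt (gamma_kernel x) (Rmin a 1) (Rmax b 1)).
  + assert (Rmin a 1 <= a) by apply Rmin_l.
    assert (Rmin a 1 <= 1) by apply Rmin_r.
    assert (b <= Rmax b 1) by apply Rmax_l.
    assert (0 < Rmin a 1) by (apply Rmin_pos; lra).
    rewrite <- (RInt_Chasles _ (Rmin a 1) a (Rmax b 1)) by (apply Hex; lra).
    rewrite <- (RInt_Chasles _ a b (Rmax b 1)) by (apply Hex; lra).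
    unfold plus; simpl.
    generalize (H0 (Rmin a 1) a ltac:(lra) ltac:(lra)) (H0 b (Rmax b 1) ltac:(lra) ltac:(lra)).
    lra.
  + assert (Rmin a 1 <= 1) by apply Rmin_r.
    assert (1 <= Rmax b 1) by apply Rmax_r.
    assert (0 < Rmin a 1) by (apply Rmin_pos; lra).
    rewrite <- (RInt_Chasles _ (Rmin a 1) 1 (Rmax b 1)) by (apply Hex; lra).
    unfold plus; simpl.
    apply Rplus_le_compat; [apply Hsmall; lra | apply Hbig; lra].
Qed.

Lemma filterlim_gamma_boundary_0 (x : R) : 0 < x ->
  filterlim (fun t => Rpower t x * exp (- t)) (at_right 0) (locally 0).
Proof.
intros Hx P [eps HP].
assert (He := cond_pos eps).
assert (Hd : 0 < Rpower eps (/ x)) by apply exp_pos.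
exists (mkposreal _ Hd). intros t Ht Ht0.
change (Rabs (t - 0) < Rpower eps (/ x)) in Ht. apply Rabs_def2 in Ht.
apply HP. change (Rabs (Rpower t x * exp (- t) - 0) < eps).
rewrite Rminus_0_r, Rabs_pos_eq
  by (left; apply Rmult_lt_0_compat; apply exp_pos).
apply Rle_lt_trans with (Rpower t x).
- rewrite <- (Rmult_1_r (Rpower t x)) at 2.
  apply Rmult_le_compat_l; [left; apply exp_pos |].
  rewrite <- exp_0. left. apply exp_increasing. lra.
- replace (pos eps) with (Rpower (Rpower eps (/ x)) x).
  + apply Rlt_Rpower_l; lra.
  + rewrite Rpower_mult, Rinv_l by lra. now apply Rpower_1.
Qed.

Lemma filterlim_gamma_boundary_infty (x : R) : 0 < x ->
  filterlim (fun t => Rpower t x * exp (- t)) (Rbar_locally p_infty) (locally 0).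
Proof.
intros Hx.
(* [ln y <= y - 1] at [y = t / (2 x)] gives [x ln t - t <= x ln (2 x) - t / 2]. *)
apply (filterlim_le_le (fun _ => 0) _ (fun t => exp (x * ln (2 * x)) * exp (- (t / 2))) 0).
- exists 1. intros t Ht. split.
  + left. apply Rmult_lt_0_compat; apply exp_pos.
  + unfold Rpower. rewrite <- !exp_plus.
    assert (Hln : ln t <= t / (2 * x) + ln (2 * x)).
    { replace t with (t / (2 * x) * (2 * x)) at 1 by (field; lra).
      assert (0 < t / (2 * x)) by (apply Rdiv_lt_0_compat; lra).
      rewrite ln_mult by lra.
      apply Rplus_le_compat_r.
      apply Rle_trans with (t / (2 * x) - 1); [| lra].
      apply Rnot_lt_le. intros Hlt. apply exp_increasing in Hlt.
      rewrite exp_ln in Hlt by assumption.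
      generalize (exp_ineq1_le (t / (2 * x) - 1)). lra. }
    assert (Hle : x * ln t + - t <= x * ln (2 * x) + - (t / 2)).
    { apply Rle_trans with (x * (t / (2 * x) + ln (2 * x)) + - t).
      - apply Rplus_le_compat_r, Rmult_le_compat_l; lra.
      - right. field. lra. }
    destruct Hle as [Hlt | ->]; [left; now apply exp_increasing | right; reflexivity].
- apply filterlim_const.
- change (is_lim (fun t => exp (x * ln (2 * x)) * exp (- (t / 2))) p_infty 0).
  replace (Finite 0) with (Rbar_mult (exp (x * ln (2 * x))) 0) by (simpl; f_equal; ring).
  apply is_lim_scal_l.
  apply is_lim_comp with m_infty.
  + apply is_lim_exp_m.
  + apply (is_lim_ext (fun t => (- / 2) * t)); [intros; field |].
    replace m_infty with (Rbar_mult (- / 2) p_infty).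
    * apply is_lim_scal_l, is_lim_id.
    * simpl. destruct (Rle_dec 0 (- / 2)); [exfalso; lra | reflexivity].
  + exists 0. easy.
Qed.

(** Integration by parts with the primitive [- t^x exp(-t)], whose boundary values vanish at both
    ends. Working with [is_gamma] instead of [Gamma] yields convergence at [x + 1] together with the
    value. *)
Lemma is_gamma_succ (x l : R) : 0 < x -> is_gamma x l -> is_gamma (x + 1) (x * l).
Proof.
intros Hx Hl.
set (F := fun t => - (Rpower t x * exp (- t))).
set (dF := fun t => Rpower t x * exp (- t) - x * (Rpower t (x - 1) * exp (- t))).
assert (HdF : forall t, 0 < t -> is_derive F t (dF t)).
{ intros t Ht.
  replace (dF t) with (opp (plus (mult (x * Rpower t (x - 1)) (exp (- t)))
     (mult (Rpower t x) (- exp (- t))))) by (unfold dF, opp, plus, mult; simpl; ring).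
  apply (is_derive_opp (fun t => Rpower t x * exp (- t))).
  apply (is_derive_mult (fun t => Rpower t x) (fun t => exp (- t))).
  - now apply is_derive_Rpower.
  - auto_derive; [easy | ring].
  - intros; apply Rmult_comm. }
(* Eventually the interval of integration lies in the positive reals, where [Rpower] is the true
   power and [F] is differentiable. *)
assert (Hpos : filter_prod (at_right 0) (Rbar_locally p_infty)
   (fun ab => forall t, Rmin (fst ab) (snd ab) <= t <= Rmax (fst ab) (snd ab) -> 0 < t)).
{ apply (Filter_prod _ _ _ (fun u => 0 < u) (fun v => 0 < v)).
  - now exists (mkposreal 1 Rlt_0_1).
  - now exists 0.
  - simpl. intros u v Hu Hv t [Ht _].
    apply Rlt_le_trans with (2 := Ht). now apply Rmin_pos. }
assert (HI : is_RInt_gen (Derive F) (at_right 0) (Rbar_locally p_infty) (- 0 - - 0)).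
{ apply is_RInt_gen_Derive.
  - revert Hpos. apply filter_imp. intros ab Hab t Ht. eexists. apply HdF. now apply Hab.
  - revert Hpos. apply filter_imp. intros ab Hab t Ht.
    apply (continuous_ext_loc _ dF).
    + exists (mkposreal t (Hab t Ht)). intros u Hu. symmetry. apply is_derive_unique, HdF.
      change (Rabs (u - t) < t) in Hu. apply Rabs_def2 in Hu. lra.
    + apply (ex_derive_continuous (K := R_AbsRing) (V := R_NormedModule)).
      specialize (Hab t Ht).
      apply (ex_derive_minus (fun t => Rpower t x * exp (- t))
        (fun t => x * (Rpower t (x - 1) * exp (- t)))).
      * apply (ex_derive_mult (fun u => Rpower u x) (fun u => exp (- u))).
        -- eexists. now apply is_derive_Rpower.
        -- auto_derive. easy.
      * apply (ex_derive_scal (fun t => Rpower t (x - 1) * exp (- t))).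
        apply (ex_derive_mult (fun u => Rpower u (x - 1)) (fun u => exp (- u))).
        -- eexists. now apply is_derive_Rpower.
        -- auto_derive. easy.
  - apply (filterlim_comp _ _ _ _ Ropp _ (locally 0)).
    + now apply filterlim_gamma_boundary_0.
    + apply (filterlim_opp (V := R_NormedModule) 0).
  - apply (filterlim_comp _ _ _ _ Ropp _ (locally 0)).
    + now apply filterlim_gamma_boundary_infty.
    + apply (filterlim_opp (V := R_NormedModule) 0). }
replace (x * l) with (plus (- 0 - - 0) (scal x l)) by (unfold plus, scal; simpl; unfold mult; simpl; ring).
apply (is_RInt_gen_ext (fun t => plus (Derive F t) (scal x (Rpower t (x - 1) * exp (- t))))).
- revert Hpos. apply filter_imp. intros ab Hab t Ht.
  rewrite (is_derive_unique _ _ _ (HdF t (Hab t ltac:(lra)))).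
  unfold dF, plus, scal; simpl; unfold mult; simpl.
  replace (x + 1 - 1) with x by ring. ring.
- apply (is_RInt_gen_plus (V := R_NormedModule) (Derive F)); [exact HI |].
  apply (is_RInt_gen_scal (V := R_NormedModule)). exact Hl.
Qed.

Lemma is_gamma_pochhammer (x l : R) (n : nat) :
  0 < x -> is_gamma x l -> is_gamma (x + INR n) (pochhammer x n * l).
Proof.
intros Hx Hl. induction n as [| n IH].
- simpl. rewrite Rplus_0_r, Rmult_1_l. exact Hl.
- rewrite S_INR, <- Rplus_assoc. simpl pochhammer.
  replace (pochhammer x n * (x + INR n) * l)
    with ((x + INR n) * (pochhammer x n * l)) by ring.
  apply is_gamma_succ; [generalize (pos_INR n); lra | exact IH].
Qed.

Lemma Gamma_eq (x l : R) : is_gamma x l -> Gamma x = l.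
Proof. intros H. now apply is_RInt_gen_unique. Qed.

Lemma Gamma_add_nat (x : R) (n : nat) :
  0 < x <= 1 -> 0 < Gamma x /\ Gamma (x + INR n) = pochhammer x n * Gamma x.
Proof.
intros Hx. destruct (ex_gamma_unit x Hx) as [l [Hl0 Hl]].
rewrite (Gamma_eq _ _ Hl). split; [exact Hl0 |].
apply Gamma_eq, is_gamma_pochhammer; [lra | exact Hl].
Qed.

Lemma Gamma_1 : Gamma 1 = 1.
Proof.
apply Gamma_eq.
set (F := fun t => - exp (- t)).
assert (HdF : forall t, Derive F t = exp (- t)).
{ intros t. apply is_derive_unique. unfold F. auto_derive; [easy | ring]. }
apply (is_RInt_gen_ext (Derive F)).
{ apply filter_forall. intros ab t _. rewrite HdF, Rminus_diag.
  unfold Rpower. rewrite Rmult_0_l, exp_0. symmetry. apply Rmult_1_l. }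
replace 1 with (- 0 - - exp (- 0)) by (rewrite Ropp_0, exp_0; ring).
apply is_RInt_gen_Derive.
- apply filter_forall. intros ab t _. unfold F. auto_derive. easy.
- apply filter_forall. intros ab t _.
  apply (continuous_ext (fun t => exp (- t))); [intros; now rewrite HdF |].
  apply (ex_derive_continuous (K := R_AbsRing) (V := R_NormedModule)).
  auto_derive. easy.
- eapply filterlim_filter_le_1; [apply filter_le_within |].
  apply (ex_derive_continuous (K := R_AbsRing) (V := R_NormedModule) F).
  unfold F. auto_derive. easy.
- apply (filterlim_comp _ _ _ _ Ropp _ (locally 0)).
  + change (is_lim (fun t => exp (- t)) p_infty 0).
    apply is_lim_comp with m_infty; [apply is_lim_exp_m | | exists 0; easy].
    change m_infty with (Rbar_opp p_infty). apply is_lim_opp, is_lim_id.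
  + apply (filterlim_opp (V := R_NormedModule) 0).
Qed.

Lemma pochhammer_1 (n : nat) : pochhammer 1 n = INR (fact n).
Proof.
induction n as [| n IH]; [reflexivity |].
rewrite fact_simpl, mult_INR, S_INR. simpl pochhammer. rewrite IH. ring.
Qed.

Lemma pochhammer_pos (q : R) (n : nat) : 0 < q -> 0 < pochhammer q n.
Proof.
intros Hq. induction n as [| n IH]; simpl; [lra |].
apply Rmult_lt_0_compat; [exact IH | generalize (pos_INR n); lra].
Qed.

Lemma Gamma_ratio (alpha : R) (n : nat) : 0 < alpha < 1 ->
  Gamma (INR n + 1) / Gamma (INR n + 1 - alpha)
  = INR (fact n) / pochhammer (1 - alpha) n / Gamma (1 - alpha).
Proof.
intros Ha.
destruct (Gamma_add_nat 1 n ltac:(lra)) as [_ H1].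
destruct (Gamma_add_nat (1 - alpha) n ltac:(lra)) as [H0 H2].
replace (INR n + 1) with (1 + INR n) by ring.
replace (1 + INR n - alpha) with (1 - alpha + INR n) by ring.
rewrite H1, H2, pochhammer_1, Gamma_1.
field. split; apply Rgt_not_eq; [apply pochhammer_pos; lra | exact H0].
Qed.

(** * Parseval's identity on roots of unity *)

Definition cis (x : R) : C := (cos x, sin x).

Lemma cis_plus (x y : R) : cis (x + y) = (cis x * cis y)%C.
Proof. unfold cis, Cmult; simpl. rewrite cos_plus, sin_plus. f_equal; ring. Qed.

Lemma Cconj_cis (x : R) : Cconj (cis x) = cis (- x).
Proof. unfold cis, Cconj; simpl. now rewrite cos_neg, sin_neg. Qed.

Lemma Cmod_cis (x : R) : Cmod (cis x) = 1.
Proof.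
unfold Cmod, cis; simpl.
replace (cos x * (cos x * 1) + sin x * (sin x * 1)) with 1; [apply sqrt_1 |].
generalize (sin2_cos2 x). unfold Rsqr. lra.
Qed.

Lemma cis_pow (x : R) (n : nat) : (cis x ^ n)%C = cis (INR n * x).
Proof.
induction n as [| n IH].
- simpl. rewrite Rmult_0_l. unfold cis. now rewrite cos_0, sin_0.
- rewrite S_INR. replace ((INR n + 1) * x) with (x + INR n * x) by ring.
  now rewrite cis_plus, <- IH.
Qed.

(** From [1 - cos y = 2 sin(y/2)^2], where [|y|/2] lies strictly between 0 and [PI]. *)
Lemma cis_neq_1 (y : R) : y <> 0 -> Rabs y < 2 * PI -> cis y <> RtoC 1.
Proof.
intros Hy0 Hy H.
assert (Hc : cos (Rabs y) = 1).
{ unfold Rabs. destruct (Rcase_abs y); rewrite ?cos_neg; exact (f_equal fst H). }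
assert (Hp : 0 < Rabs y) by now apply Rabs_pos_lt.
assert (Hs : 0 < sin (Rabs y / 2)) by (apply sin_gt_0; lra).
replace (Rabs y) with (2 * (Rabs y / 2)) in Hc by field.
rewrite cos_2a_sin in Hc. nra.
Qed.

Lemma sum_n_geometric_C (z : C) (n : nat) :
  ((1 - z) * sum_n (fun j => z ^ j) n)%C = (1 - z ^ S n)%C.
Proof.
induction n as [| n IH].
- rewrite sum_O. simpl. ring.
- rewrite sum_Sn. change (plus ?a ?b) with (a + b)%C.
  rewrite Cmult_plus_distr_l, IH. simpl. ring.
Qed.

Lemma sum_n_roots_of_unity (n : nat) (y : R) :
  cis y <> RtoC 1 -> cis (INR (S n) * y) = RtoC 1 ->
  sum_n (fun j => cis (INR j * y)) n = RtoC 0.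
Proof.
intros H1 HN.
rewrite (sum_n_ext _ (fun j => (cis y ^ j)%C)) by (intros; now rewrite cis_pow).
assert (H := sum_n_geometric_C (cis y) n).
rewrite cis_pow, HN in H.
replace (1 - 1)%C with (RtoC 0) in H by ring.
destruct (Ceq_dec (sum_n (fun j => (cis y ^ j)%C) n) 0) as [H0 | H0]; [exact H0 |].
exfalso. apply Cmult_neq_0 with (2 := H0) (3 := H).
intros Hz. apply H1.
replace (cis y) with (1 - (1 - cis y))%C by ring. rewrite Hz. ring.
Qed.

Lemma RtoC_sum_n (u : nat -> R) (n : nat) :
  RtoC (sum_n u n) = sum_n (fun k => RtoC (u k)) n.
Proof.
induction n as [| n IH]; [now rewrite !sum_O |].
rewrite !sum_Sn, <- IH. apply RtoC_plus.
Qed.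

Lemma Cconj_sum_n (u : nat -> C) (n : nat) :
  Cconj (sum_n u n) = sum_n (fun k => Cconj (u k)) n.
Proof.
induction n as [| n IH]; [now rewrite !sum_O |].
rewrite !sum_Sn, <- IH. apply Cplus_conj.
Qed.

Lemma sum_n_single (u : nat -> C) (n k : nat) : (k <= n)%nat ->
  (forall j, (j <= n)%nat -> j <> k -> u j = RtoC 0) -> sum_n u n = u k.
Proof.
revert k. induction n as [| n IH]; intros k Hk Hu.
- rewrite sum_O. now replace k with 0%nat by lia.
- rewrite sum_Sn. change (plus ?a ?b) with (a + b)%C.
  destruct (Nat.eq_dec k (S n)) as [-> | Hne].
  + rewrite (sum_n_ext_loc _ (fun _ => RtoC 0)) by (intros; apply Hu; lia).
    assert (H0 : sum_n (fun _ => RtoC 0) n = RtoC 0).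
    { clear. induction n as [| n IH]; [apply sum_O |].
      rewrite sum_Sn, IH. apply Cplus_0_l. }
    rewrite H0. apply Cplus_0_l.
  + rewrite (IH k) by (try lia; intros; apply Hu; lia).
    rewrite (Hu (S n)) by lia. apply Cplus_0_r.
Qed.

(** With [n + 1] nodes and degree at most [n], two distinct frequencies differ by less than [n + 1]
    in absolute value. Hence no aliasing occurs and the discrete mean is exact. *)
Lemma parseval_roots_of_unity (p : nat -> C) (n : nat) :
  let w := 2 * PI / INR (S n) in
  sum_n (fun j => Cmod (sum_n (fun k => p k * cis (INR j * w) ^ k)%C n) ^ 2) n
  = INR (S n) * sum_n (fun k => Cmod (p k) ^ 2) n.
Proof.
intros w.
assert (HN : 0 < INR (S n)) by apply lt_0_INR, Nat.lt_0_succ.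
apply RtoC_inj.
rewrite RtoC_mult, !RtoC_sum_n.
(* Writing the squared modulus as a product with the conjugate gives a triple sum. Once the sum over
   the nodes [j] is innermost, only the diagonal [l = k] survives. *)
set (t := fun k l j => (p k * Cconj (p l) * cis (INR j * ((INR k - INR l) * w)))%C).
rewrite (sum_n_ext _ (fun j => sum_n (fun k => sum_n (fun l => t k l j) n) n)).
2: { intros j. rewrite Cmod2_conj, Cconj_sum_n.
     rewrite <- (sum_n_mult_r (K := C_Ring)).
     apply sum_n_ext. intros k.
     rewrite <- (sum_n_mult_l (K := C_Ring)).
     apply sum_n_ext. intros l. unfold t.
     change (mult ?a ?b) with (a * b)%C.
     rewrite Cmult_conj, !cis_pow, Cconj_cis.
     replace (INR j * ((INR k - INR l) * w))
       with (INR k * (INR j * w) + - (INR l * (INR j * w))) by ring.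
     rewrite cis_plus.
     (* [eq_at C] restates the equality at the plain type instead of the carrier of an algebraic
        structure, so that [ring] recognises it. *)
     eq_at C. ring. }
rewrite sum_n_switch.
rewrite <- (sum_n_mult_l (K := C_Ring)).
apply sum_n_ext_loc. intros k Hk.
rewrite sum_n_switch.
assert (Ht : forall l, sum_n (fun j => t k l j) n
  = (p k * Cconj (p l) * sum_n (fun j => cis (INR j * ((INR k - INR l) * w))) n)%C).
{ intros l. exact (sum_n_mult_l (K := C_Ring) _ _ n). }
rewrite (sum_n_single _ n k Hk).
- rewrite Ht, Cmod2_conj.
  rewrite (sum_n_ext _ (fun j => RtoC 1)).
  + rewrite <- (RtoC_sum_n (fun _ => 1)), sum_n_const, Rmult_1_r.
    apply Cmult_comm.
  + intros j. unfold cis. rewrite Rminus_diag, Rmult_0_l, Rmult_0_r, cos_0, sin_0. reflexivity.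
- intros l Hl Hlk. rewrite Ht, sum_n_roots_of_unity; [apply Cmult_0_r | |].
  + assert (Hkl : INR k - INR l <> 0).
    { intros H. apply Hlk. apply INR_eq. lra. }
    assert (Hw : 0 < w) by (apply Rdiv_lt_0_compat; [generalize PI_RGT_0; lra | exact HN]).
    apply cis_neq_1.
    * apply Rmult_integral_contrapositive. split; [exact Hkl | lra].
    * rewrite Rabs_mult, (Rabs_pos_eq w) by lra.
      replace (2 * PI) with (INR (S n) * w) by (unfold w; field; lra).
      apply Rmult_lt_compat_r; [exact Hw |].
      apply le_INR in Hk, Hl. rewrite S_INR.
      generalize (pos_INR k) (pos_INR l). intros.
      apply Rabs_def1; lra.
  (* [k - l] may be negative, whereas [cos_period] and [sin_period] take a natural number of
     periods; hence two separate factors. *)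
  + replace (INR (S n) * ((INR k - INR l) * w)) with (2 * INR k * PI + - (2 * INR l * PI))
      by (unfold w; field; lra).
    rewrite cis_plus, <- Cconj_cis.
    assert (H1 : forall q, cis (2 * INR q * PI) = RtoC 1).
    { intros q. unfold cis.
      replace (2 * INR q * PI) with (0 + 2 * INR q * PI) by ring.
      now rewrite cos_period, sin_period, cos_0, sin_0. }
    rewrite !H1. unfold Cconj, Cmult, RtoC; simpl. f_equal; ring.
Qed.

Lemma parseval_le (p : nat -> C) (n : nat) (B : R) :
  (forall x, Cmod (sum_n (fun k => p k * cis x ^ k)%C n) <= B) ->
  sum_n (fun k => Cmod (p k) ^ 2) n <= B ^ 2.
Proof.
intros HB.
assert (HN : 0 < INR (S n)) by apply lt_0_INR, Nat.lt_0_succ.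
apply Rmult_le_reg_l with (1 := HN).
rewrite <- parseval_roots_of_unity, <- (sum_n_const n (B ^ 2)).
apply sum_n_m_le. intros j.
apply pow_incr. split; [apply Cmod_ge_0 | apply HB].
Qed.

(** * Moments of the Beta weight *)

Lemma sum_n_Rmult_l (c : R) (u : nat -> R) (n : nat) :
  sum_n (fun k => c * u k) n = c * sum_n u n.
Proof. exact (sum_n_mult_l (K := R_Ring) c u n). Qed.

Lemma sum_n_Rmult_r (c : R) (u : nat -> R) (n : nat) :
  sum_n (fun k => u k * c) n = sum_n u n * c.
Proof. exact (sum_n_mult_r (K := R_Ring) c u n). Qed.

(* The Beta integral of [u^k (1-u)^(b-1)] over [[0,1]]. *)
Definition beta_moment (b : R) (k : nat) : R := INR (fact k) / pochhammer b (S k).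

Lemma beta_moment_pos (b : R) (k : nat) : 0 < b -> 0 < beta_moment b k.
Proof.
intros Hb. apply Rdiv_lt_0_compat; [apply lt_0_INR, lt_O_fact | now apply pochhammer_pos].
Qed.

Lemma beta_moment_0 (b : R) : 0 < b -> beta_moment b 0 = / b.
Proof. intros Hb. unfold beta_moment. simpl. field. lra. Qed.

Lemma beta_moment_S (b : R) (k : nat) : 0 < b ->
  beta_moment b (S k) = INR (S k) * beta_moment b k / (INR (S k) + b).
Proof.
intros Hb. unfold beta_moment.
rewrite fact_simpl, mult_INR.
change (pochhammer b (S (S k))) with (pochhammer b (S k) * (b + INR (S k))).
assert (0 < pochhammer b (S k)) by now apply pochhammer_pos.
assert (0 < INR (S k)) by apply lt_0_INR, Nat.lt_0_succ.
field. lra.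
Qed.

(* The antiderivative of [u^k (1-u)^(b-1)] that vanishes at [u = 1]. *)
Fixpoint beta_primitive (b : R) (k : nat) (u : R) : R :=
  match k with
  | O => - (Rpower (1 - u) b / b)
  | S j => (INR k * beta_primitive b j u - u ^ k * Rpower (1 - u) b) / (INR k + b)
  end.

(** The recursion is integration by parts read backwards. With [(1-u)^b = (1-u) (1-u)^(b-1)] the
    derivative of the numerator is [(1-u)^(b-1)] times [k u^(k-1) - k u^(k-1) (1-u) + b u^k], which
    is [(k+b) u^k]. *)
Lemma is_derive_beta_primitive (b : R) (k : nat) (u : R) : 0 < b -> u < 1 ->
  is_derive (beta_primitive b k) u (u ^ k * Rpower (1 - u) (b - 1)).
Proof.
intros Hb Hu.
assert (HR : is_derive (fun v => Rpower (1 - v) b) u (- (b * Rpower (1 - u) (b - 1)))).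
{ replace (- (b * Rpower (1 - u) (b - 1)))
    with ((- 1) * (b * Rpower (1 - u) (b - 1))) by ring.
  assert (H1 : is_derive (fun v : R => 1 - v) u (- 1)) by (auto_derive; [easy | ring]).
  apply (is_derive_comp (fun v => Rpower v b) (fun v => 1 - v)); [| exact H1].
  apply is_derive_Rpower. lra. }
induction k as [| k IH].
- replace (u ^ 0 * Rpower (1 - u) (b - 1))
    with (- / b * - (b * Rpower (1 - u) (b - 1))) by (simpl; field; lra).
  apply (is_derive_ext (fun v => - / b * Rpower (1 - v) b)).
  + intros v. simpl. field. lra.
  + now apply is_derive_scal.
- assert (HS : 0 < INR (S k)) by apply lt_0_INR, Nat.lt_0_succ.
  apply (is_derive_ext (fun v => / (INR (S k) + b) *
    (INR (S k) * beta_primitive b k v - v ^ S k * Rpower (1 - v) b))).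
  { intros v. cbn [beta_primitive]. apply Rmult_comm. }
  replace (u ^ S k * Rpower (1 - u) (b - 1)) with (/ (INR (S k) + b) *
    (INR (S k) * (u ^ k * Rpower (1 - u) (b - 1))
     - (INR (S k) * 1 * u ^ Nat.pred (S k) * Rpower (1 - u) b
        + u ^ S k * - (b * Rpower (1 - u) (b - 1))))).
  2: { replace (Rpower (1 - u) b) with ((1 - u) * Rpower (1 - u) (b - 1)).
       - rewrite <- tech_pow_Rmult. simpl Nat.pred. field. lra.
       - rewrite <- (Rpower_1 (1 - u)) at 1 by lra.
         rewrite <- Rpower_plus. f_equal. ring. }
  apply is_derive_scal.
  apply (is_derive_minus (fun v => INR (S k) * beta_primitive b k v)
           (fun v => v ^ S k * Rpower (1 - v) b)).
  + now apply is_derive_scal.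
  + apply (is_derive_mult (fun v => v ^ S k) (fun v => Rpower (1 - v) b)).
    * apply (is_derive_pow (fun v => v) (S k)). apply (is_derive_id u).
    * exact HR.
    * intros; apply Rmult_comm.
Qed.

(** Since the primitive vanishes at [u = 1], this identifies [beta_moment] with the beta integral.
    At [u = 0] the boundary term drops out for positive index, leaving the recursion of
    [beta_moment_S]. *)
Lemma beta_primitive_0 (b : R) (k : nat) : 0 < b ->
  beta_primitive b k 0 = - beta_moment b k.
Proof.
intros Hb. assert (H1 : Rpower (1 - 0) b = 1).
{ unfold Rpower. now rewrite Rminus_0_r, ln_1, Rmult_0_r, exp_0. }
induction k as [| k IH].
- rewrite beta_moment_0 by assumption. simpl. rewrite H1. field. lra.
- rewrite beta_moment_S by assumption. cbn [beta_primitive]. rewrite IH, H1, pow_i by lia.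
  generalize (pos_INR (S k)). intros. field. lra.
Qed.

(** A rate for the vanishing at [u = 1], from which [beta_functional_nonneg] picks an explicit [u]
    close to 1. *)
Lemma beta_primitive_bound (b : R) (k : nat) : 0 < b ->
  exists B, 0 <= B /\ forall u, 0 <= u < 1 -> Rabs (beta_primitive b k u) <= B * Rpower (1 - u) b.
Proof.
intros Hb. induction k as [| k [B [HB0 HB]]].
- exists (/ b). split; [left; now apply Rinv_0_lt_compat |].
  intros u Hu. simpl. rewrite Rabs_Ropp, Rabs_pos_eq; [right; field; lra |].
  left. apply Rdiv_lt_0_compat; [apply exp_pos | exact Hb].
- assert (HS : 0 < INR (S k)) by apply lt_0_INR, Nat.lt_0_succ.
  exists ((INR (S k) * B + 1) / (INR (S k) + b)). split.
  { apply Rmult_le_pos; [nra | left; apply Rinv_0_lt_compat; lra]. }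
  intros u Hu. cbn [beta_primitive].
  unfold Rdiv. rewrite Rabs_mult, (Rabs_pos_eq (/ _)) by (left; apply Rinv_0_lt_compat; lra).
  rewrite (Rmult_assoc _ (/ _)), (Rmult_comm (/ _)), <- Rmult_assoc.
  apply Rmult_le_compat_r; [left; apply Rinv_0_lt_compat; lra |].
  eapply Rle_trans; [apply Rabs_triang |].
  rewrite Rabs_Ropp, !Rabs_mult, (Rabs_pos_eq (INR (S k))) by lra.
  rewrite (Rabs_pos_eq (u ^ S k)) by (apply pow_le; lra).
  rewrite (Rabs_pos_eq (Rpower _ _)) by (left; apply exp_pos).
  assert (u ^ S k <= 1) by (rewrite <- (pow1 (S k)); apply pow_incr; lra).
  assert (0 < Rpower (1 - u) b) by apply exp_pos.
  specialize (HB u Hu). nra.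
Qed.

Lemma beta_primitive_sum_bound (b : R) (q : nat -> R) (n : nat) : 0 < b ->
  exists B, 0 <= B /\ forall u, 0 <= u < 1 ->
    Rabs (sum_n (fun k => q k * beta_primitive b k u) n) <= B * Rpower (1 - u) b.
Proof.
intros Hb.
assert (Hk : forall k, exists B, 0 <= B /\ forall u, 0 <= u < 1 ->
  Rabs (q k * beta_primitive b k u) <= B * Rpower (1 - u) b).
{ intros k. destruct (beta_primitive_bound b k Hb) as [B [HB0 HB]].
  exists (Rabs (q k) * B). split; [apply Rmult_le_pos; [apply Rabs_pos | exact HB0] |].
  intros u Hu. rewrite Rabs_mult, Rmult_assoc.
  apply Rmult_le_compat_l; [apply Rabs_pos | now apply HB]. }
induction n as [| n [B [HB0 HB]]].
- destruct (Hk 0%nat) as [B [HB0 HB]]. exists B. split; [exact HB0 |].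
  intros u Hu. rewrite sum_O. now apply HB.
- destruct (Hk (S n)) as [B' [HB0' HB']]. exists (B + B'). split; [lra |].
  intros u Hu. rewrite sum_Sn.
  eapply Rle_trans; [apply Rabs_triang |].
  specialize (HB u Hu). specialize (HB' u Hu). lra.
Qed.

(* Integration against [(1-u)^(b-1)] preserves signs; arguing through the
   primitives avoids the integral, improper at [u = 1]. *)
Lemma beta_functional_nonneg (b T : R) (q : nat -> R) (n : nat) : 0 < b ->
  (forall u, 0 <= u < 1 -> 0 <= sum_n (fun k => q k * u ^ k) n + T) ->
  0 <= sum_n (fun k => q k * beta_moment b k) n + T / b.
Proof.
intros Hb Hq.
(* The constant [T] will be a truncation error; it is carried by the moment of index 0, which is
   [1/b]. *)
set (Phi := fun u => sum_n (fun k => q k * beta_primitive b k u) n + T * beta_primitive b 0 u).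
set (dPhi := fun u => sum_n (fun k => q k * (u ^ k * Rpower (1 - u) (b - 1))) n
  + T * (u ^ 0 * Rpower (1 - u) (b - 1))).
assert (HPhi : forall u, u < 1 -> is_derive Phi u (dPhi u)).
{ intros u Hu.
  apply (is_derive_plus (fun u => sum_n (fun k => q k * beta_primitive b k u) n)
    (fun u => T * beta_primitive b 0 u)).
  - apply (is_derive_sum_n (fun k u => q k * beta_primitive b k u)).
    intros k _. now apply is_derive_scal, is_derive_beta_primitive.
  - now apply is_derive_scal, is_derive_beta_primitive. }
assert (Hinc : forall u, 0 < u < 1 -> Phi 0 <= Phi u).
{ intros u Hu.
  destruct (MVT_gen Phi 0 u dPhi) as [c [Hc Heq]].
  - intros x Hx. rewrite Rmax_right in Hx by lra. apply HPhi. lra.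
  - intros x Hx. rewrite Rmax_right in Hx by lra.
    apply continuity_pt_filterlim.
    apply (ex_derive_continuous (K := R_AbsRing) (V := R_NormedModule)).
    eexists. apply HPhi. lra.
  - rewrite Rmin_left, Rmax_right in Hc by lra.
    enough (0 <= dPhi c) by nra.
    unfold dPhi.
    rewrite (sum_n_ext _ (fun k => q k * c ^ k * Rpower (1 - c) (b - 1)))
      by (intros; symmetry; apply Rmult_assoc).
    rewrite sum_n_Rmult_r.
    assert (0 <= sum_n (fun k => q k * c ^ k) n + T) by (apply Hq; lra).
    assert (0 < Rpower (1 - c) (b - 1)) by apply exp_pos.
    apply Rle_trans with ((sum_n (fun k => q k * c ^ k) n + T) * Rpower (1 - c) (b - 1)).
    + apply Rmult_le_pos; lra.
    + right. simpl. ring. }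
assert (H0 : Phi 0 = - (sum_n (fun k => q k * beta_moment b k) n + T / b)).
{ unfold Phi. rewrite beta_primitive_0, beta_moment_0 by assumption.
  rewrite (sum_n_ext _ (fun k => (- 1) * (q k * beta_moment b k))).
  - rewrite sum_n_Rmult_l. field. lra.
  - intros k. rewrite beta_primitive_0 by assumption.
    eq_at R. ring. }
destruct (beta_primitive_sum_bound b q n Hb) as [B1 [HB10 HB1]].
destruct (beta_primitive_bound b 0 Hb) as [B2 [HB20 HB2]].
apply Rnot_lt_le. intros Hneg.
(* If the claim fails, [Phi 0 > 0]. For [d = (1-u)^b] the two bounds give [Phi u <= B d], so
   [d <= Phi 0 / (2 B)] forces [Phi u <= Phi 0 / 2], against [Phi 0 <= Phi u]. The [+ 1] makes [B]
   positive, and the cap [/ 2] on [d] keeps [u] positive. *)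
set (B := B1 + Rabs T * B2 + 1).
assert (HB : 0 < B) by (generalize (Rmult_le_pos _ _ (Rabs_pos T) HB20); unfold B; lra).
set (d := Rmin (/ 2) (Phi 0 / (2 * B))).
assert (Hd : 0 < d) by (apply Rmin_pos; [lra | apply Rdiv_lt_0_compat; lra]).
assert (Hd1 : d <= / 2) by apply Rmin_l.
assert (Hd2 : d <= Phi 0 / (2 * B)) by apply Rmin_r.
set (u := 1 - Rpower d (/ b)).
assert (Hu : Rpower (1 - u) b = d).
{ unfold u. replace (1 - (1 - Rpower d (/ b))) with (Rpower d (/ b)) by ring.
  rewrite Rpower_mult, Rinv_l by lra. now apply Rpower_1. }
assert (Hu01 : 0 < u < 1).
{ unfold u. assert (0 < Rpower d (/ b)) by apply exp_pos.
  assert (Rpower d (/ b) < Rpower 1 (/ b)).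
  { apply Rlt_Rpower_l; [now apply Rinv_0_lt_compat | lra]. }
  assert (Rpower 1 (/ b) = 1) by (unfold Rpower; now rewrite ln_1, Rmult_0_r, exp_0).
  lra. }
specialize (Hinc u Hu01).
specialize (HB1 u ltac:(lra)). specialize (HB2 u ltac:(lra)).
rewrite Hu in HB1, HB2.
assert (Phi u <= B * d).
{ unfold Phi, B.
  apply Rle_trans with (Rabs (sum_n (fun k => q k * beta_primitive b k u) n)
     + Rabs (T * beta_primitive b 0 u)).
  - apply Rplus_le_compat; apply Rle_abs.
  - rewrite Rabs_mult.
    assert (Rabs T * Rabs (beta_primitive b 0 u) <= Rabs T * (B2 * d))
      by (apply Rmult_le_compat_l; [apply Rabs_pos | exact HB2]).
    nra. }
assert (B * d <= Phi 0 / 2).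
{ apply Rle_trans with (B * (Phi 0 / (2 * B))).
  - apply Rmult_le_compat_l; lra.
  - right. field. lra. }
lra.
Qed.

(** * Quadratic means of the derivative *)

Lemma pow_n_Cpow (z : C) (n : nat) : @pow_n C_Ring z n = (z ^ n)%C.
Proof. induction n as [| n IH]; [reflexivity |]. simpl. now rewrite IH. Qed.

Lemma Re_sum_n (u : nat -> C) (n : nat) : Re (sum_n u n) = sum_n (fun k => Re (u k)) n.
Proof. induction n as [| n IH]; [now rewrite !sum_O |]. now rewrite !sum_Sn, <- IH. Qed.

Lemma Im_sum_n (u : nat -> C) (n : nat) : Im (sum_n u n) = sum_n (fun k => Im (u k)) n.
Proof. induction n as [| n IH]; [now rewrite !sum_O |]. now rewrite !sum_Sn, <- IH. Qed.

Lemma is_series_C (u : nat -> C) (l : C) :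
  is_series (V := C_NormedModule) u l
  <-> is_series (fun n => Re (u n)) (Re l) /\ is_series (fun n => Im (u n)) (Im l).
Proof.
unfold is_series. split.
- intros H. split; apply filterlim_locally; intros eps;
    generalize (proj1 (filterlim_locally _ _) H eps); apply filter_imp;
    intros n [H1 H2]; rewrite <- ?Re_sum_n, <- ?Im_sum_n; assumption.
- intros [H1 H2]. apply filterlim_locally. intros eps.
  generalize (filter_and _ _ (proj1 (filterlim_locally _ _) H1 eps)
    (proj1 (filterlim_locally _ _) H2 eps)).
  apply filter_imp. intros n. rewrite <- Re_sum_n, <- Im_sum_n. intros H. exact H.
Qed.

Lemma is_pseries_C (a : nat -> C) (z l : C) :
  is_pseries (K := C_AbsRing) (V := C_NormedModule) a z l ->
  is_series (V := C_NormedModule) (fun n => (a n * z ^ n)%C) l.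
Proof.
apply is_series_ext. intros n.
change (scal (pow_n z n) (a n)) with (@pow_n C_Ring z n * a n)%C.
rewrite pow_n_Cpow. apply Cmult_comm.
Qed.

Lemma ex_series_bounded (u : nat -> R) : ex_series u -> exists B, forall n, Rabs (u n) <= B.
Proof.
intros H. apply ex_series_lim_0 in H.
destruct (filterlim_bounded (K := R_AbsRing) (V := R_NormedModule) u) as [B HB].
- now exists 0.
- now exists B.
Qed.

Lemma CV_radius_dominated (x y : nat -> R) :
  (forall n, Rabs (x n) <= y n) -> Rbar_le (CV_radius y) (CV_radius x).
Proof.
intros Hxy. apply (proj2 (CV_radius_bounded y)). intros r [B HB].
apply (proj1 (CV_radius_bounded x)). exists B. intros n.
eapply Rle_trans; [| apply (HB n)]. rewrite !Rabs_mult.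
apply Rmult_le_compat_r; [apply Rabs_pos |].
eapply Rle_trans; [apply Hxy | apply Rle_abs].
Qed.

Lemma CV_radius_ge_1 (x : nat -> R) (t : R) :
  (forall r, 0 <= r < 1 -> exists B, forall n, Rabs (x n * r ^ n) <= B) ->
  Rabs t < 1 -> Rbar_lt (Rabs t) (CV_radius x).
Proof.
intros Hx Ht.
apply Rbar_lt_le_trans with ((1 + Rabs t) / 2); [simpl; lra |].
apply (proj1 (CV_radius_bounded x)). apply Hx.
generalize (Rabs_pos t). lra.
Qed.

(** Convergence at the real point [r] of the disc bounds the terms there, hence bounds [|a_n| r^n].
    As [r < 1] is arbitrary, convergence on the disc becomes absolute. *)
Lemma CV_radius_Cmod (a : nat -> C) (f : C -> C) (t : R) :
  (forall z : C, unit_disc z ->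
     is_pseries (K := C_AbsRing) (V := C_NormedModule) a z (f z)) ->
  Rabs t < 1 -> Rbar_lt (Rabs t) (CV_radius (fun n => Cmod (a n))).
Proof.
intros Hf. apply CV_radius_ge_1. intros r Hr.
assert (Hd : unit_disc (RtoC r)) by (unfold unit_disc; rewrite Cmod_R, Rabs_pos_eq; lra).
destruct (proj1 (is_series_C _ _) (is_pseries_C _ _ _ (Hf _ Hd))) as [H1 H2].
destruct (ex_series_bounded _ (ex_intro _ _ H1)) as [B1 HB1].
destruct (ex_series_bounded _ (ex_intro _ _ H2)) as [B2 HB2].
exists (sqrt (B1 ^ 2 + B2 ^ 2)). intros n.
replace (Rabs (Cmod (a n) * r ^ n)) with (Cmod (a n * RtoC r ^ n)).
- unfold Cmod. apply sqrt_le_1_alt.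
  apply Rplus_le_compat; rewrite <- (pow2_abs (_ (a n * _)%C)); apply pow_incr;
   (split; [apply Rabs_pos |]); [apply HB1 | apply HB2].
- rewrite Cmod_mult, Cmod_pow, Cmod_R, Rabs_mult, RPow_abs.
  now rewrite (Rabs_pos_eq (Cmod _)) by apply Cmod_ge_0.
Qed.

(* Differentiating along a radius reduces termwise differentiation of a complex
   power series to the real theorem, applied to the real and imaginary parts. *)
Lemma is_derive_radial (f : C -> C) (u d : C) (t : R) :
  is_derive (K := C_AbsRing) (V := C_NormedModule) f (t * u)%C d ->
  is_derive (fun s : R => Re (f (s * u)%C)) t (Re (u * d)) /\
  is_derive (fun s : R => Im (f (s * u)%C)) t (Im (u * d)).
Proof.
intros [_ Hd].
assert (Hloc : forall eps : posreal, locally t (fun s : R =>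
  Cmod (f (s * u)%C - f (t * u)%C - (s * u - t * u) * d)%C <= eps * Rabs (s - t))).
{ intros eps.
  (* The [+ 1] keeps the scaling factor positive even for [u = 0]. *)
  assert (He : 0 < eps / (Cmod u + 1)).
  { apply Rdiv_lt_0_compat; [apply cond_pos | generalize (Cmod_ge_0 u); lra]. }
  destruct (Hd (t * u)%C (fun P HP => HP) (mkposreal _ He)) as [del Hdel].
  assert (Hdel' : 0 < del / (Cmod u + 1)).
  { apply Rdiv_lt_0_compat; [apply cond_pos | generalize (Cmod_ge_0 u); lra]. }
  exists (mkposreal _ Hdel'). intros s Hs.
  change (Rabs (s - t) < del / (Cmod u + 1)) in Hs.
  assert (Hsu : Cmod (s * u - t * u)%C = Rabs (s - t) * Cmod u).
  { replace (s * u - t * u)%C with (RtoC (s - t) * u)%C by (rewrite RtoC_minus; ring).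
    now rewrite Cmod_mult, Cmod_R. }
  assert (Hu := Cmod_ge_0 u).
  assert (Hball : Cmod (s * u - t * u)%C < del).
  { rewrite Hsu. apply Rle_lt_trans with (Rabs (s - t) * (Cmod u + 1)).
    - apply Rmult_le_compat_l; [apply Rabs_pos | lra].
    - apply Rmult_lt_compat_r with (r := Cmod u + 1) in Hs; [| lra].
      replace (del / (Cmod u + 1) * (Cmod u + 1)) with (pos del) in Hs by (field; lra).
      exact Hs. }
  specialize (Hdel (s * u)%C Hball).
  change (Cmod (f (s * u)%C - f (t * u)%C - (s * u - t * u) * d)%C
    <= eps / (Cmod u + 1) * Cmod (s * u - t * u)%C) in Hdel.
  eapply Rle_trans; [exact Hdel |]. rewrite Hsu.
  replace (eps / (Cmod u + 1) * (Rabs (s - t) * Cmod u))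
    with (eps * Rabs (s - t) * (Cmod u / (Cmod u + 1))) by (field; lra).
  rewrite <- (Rmult_1_r (eps * Rabs (s - t))) at 2.
  apply Rmult_le_compat_l.
  - apply Rmult_le_pos; [left; apply cond_pos | apply Rabs_pos].
  - apply Rmult_le_reg_r with (Cmod u + 1); [lra |].
    replace (Cmod u / (Cmod u + 1) * (Cmod u + 1)) with (Cmod u) by (field; lra). lra. }
split.
- split; [apply is_linear_scal_l |].
  intros x Hx eps. rewrite <- (is_filter_lim_locally_unique _ _ Hx).
  generalize (Hloc eps). apply filter_imp. intros s Hs.
  change (Rabs (Re (f (s * u)%C) - Re (f (t * u)%C) - (s - t) * Re (u * d)) <= eps * Rabs (s - t)).
  eapply Rle_trans; [| exact Hs].
  eapply Rle_trans; [| apply re_le_Cmod].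
  right. f_equal. unfold Cminus, Cplus, Copp, Cmult, RtoC, Re; simpl. ring.
- split; [apply is_linear_scal_l |].
  intros x Hx eps. rewrite <- (is_filter_lim_locally_unique _ _ Hx).
  generalize (Hloc eps). apply filter_imp. intros s Hs.
  change (Rabs (Im (f (s * u)%C) - Im (f (t * u)%C) - (s - t) * Im (u * d)) <= eps * Rabs (s - t)).
  eapply Rle_trans; [| exact Hs].
  eapply Rle_trans; [| eapply Rle_trans; [apply Rmax_r | apply Rmax_Cmod]].
  right. f_equal. unfold Cminus, Cplus, Copp, Cmult, RtoC, Im; simpl. ring.
Qed.

Definition derive_coef (a : nat -> C) (n : nat) : C := (INR (S n) * a (S n))%C.

(** The derivative of [s |-> f (s u)] is [u f'(s u)]; this is the origin of the extra factor [u] on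
    both sides. *)
Lemma is_series_C_derive (a : nat -> C) (f : C -> C) (u : C) (t : R) :
  (forall z : C, unit_disc z ->
     is_pseries (K := C_AbsRing) (V := C_NormedModule) a z (f z)) ->
  Cmod u = 1 -> Rabs t < 1 ->
  ex_derive (K := C_AbsRing) (V := C_NormedModule) f (t * u)%C ->
  is_series (V := C_NormedModule) (fun n => (derive_coef a n * t ^ n * u ^ S n)%C)
    (u * C_derive f (t * u))%C.
Proof.
intros Hf Hu Ht Hex.
destruct (is_derive_radial f u _ t (C_derive_correct f (t * u)%C (RtoC 0) Hex)) as [HRe HIm].
assert (Hs : forall s : R, Rabs s < 1 ->
  is_series (V := C_NormedModule) (fun n => (a n * u ^ n * s ^ n)%C) (f (s * u)%C)).
{ intros s Hs.
  assert (Hd : unit_disc (s * u)%C) by (unfold unit_disc; rewrite Cmod_mult, Cmod_R, Hu; lra).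
  generalize (is_pseries_C _ _ _ (Hf _ Hd)). apply is_series_ext. intros n.
  rewrite Cpow_mult_l, (Cmult_comm (RtoC s ^ n)%C). apply Cmult_assoc. }
assert (Hnear : locally t (fun s : R => Rabs s < 1)).
{ assert (Hp : 0 < 1 - Rabs t) by lra.
  exists (mkposreal _ Hp). intros s Hst. change (Rabs (s - t) < 1 - Rabs t) in Hst.
  replace s with (s - t + t) by ring. eapply Rle_lt_trans; [apply Rabs_triang | lra]. }
set (x := fun n => Re (a n * u ^ n)%C). set (y := fun n => Im (a n * u ^ n)%C).
assert (Hau : forall n, Cmod (a n * u ^ n)%C = Cmod (a n)).
{ intros n. rewrite Cmod_mult, Cmod_pow, Hu, pow1. ring. }
assert (HCx : Rbar_lt (Rabs t) (CV_radius x)).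
{ eapply Rbar_lt_le_trans; [apply (CV_radius_Cmod a f t Hf Ht) |].
  apply CV_radius_dominated. intros n. rewrite <- Hau. apply re_le_Cmod. }
assert (HCy : Rbar_lt (Rabs t) (CV_radius y)).
{ eapply Rbar_lt_le_trans; [apply (CV_radius_Cmod a f t Hf Ht) |].
  apply CV_radius_dominated. intros n. rewrite <- Hau.
  eapply Rle_trans; [apply Rmax_r | apply Rmax_Cmod]. }
assert (Hx : forall s : R, Rabs s < 1 -> PSeries x s = Re (f (s * u)%C)).
{ intros s Hs1. apply is_series_unique.
  generalize (proj1 (proj1 (is_series_C _ _) (Hs s Hs1))). apply is_series_ext.
  intros n. unfold x. rewrite <- RtoC_pow. unfold Re. simpl. ring. }
assert (Hy : forall s : R, Rabs s < 1 -> PSeries y s = Im (f (s * u)%C)).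
{ intros s Hs1. apply is_series_unique.
  generalize (proj2 (proj1 (is_series_C _ _) (Hs s Hs1))). apply is_series_ext.
  intros n. unfold y. rewrite <- RtoC_pow. unfold Im. simpl. ring. }
assert (Hdx : Derive (PSeries x) t = Re (u * C_derive f (t * u))%C).
{ apply is_derive_unique. apply is_derive_ext_loc with (2 := HRe).
  revert Hnear. apply filter_imp. intros s Hs1. symmetry. now apply Hx. }
assert (Hdy : Derive (PSeries y) t = Im (u * C_derive f (t * u))%C).
{ apply is_derive_unique. apply is_derive_ext_loc with (2 := HIm).
  revert Hnear. apply filter_imp. intros s Hs1. symmetry. now apply Hy. }
apply is_series_C. rewrite <- Hdx, <- Hdy. split.
- generalize (is_pseries_derive x t HCx). apply is_series_ext. intros n.
  rewrite pow_n_pow. unfold PS_derive, x, derive_coef, scal; simpl.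
  unfold mult; simpl. rewrite <- RtoC_pow. unfold Re. simpl. ring.
- generalize (is_pseries_derive y t HCy). apply is_series_ext. intros n.
  rewrite pow_n_pow. unfold PS_derive, y, derive_coef, scal; simpl.
  unfold mult; simpl. rewrite <- RtoC_pow. unfold Im. simpl. ring.
Qed.

(** The error involves only the moduli of the terms. On a circle it is therefore independent of the
    angle, and a bound on [f'] passes to its Taylor polynomials uniformly. *)
Lemma Cmod_sum_n_le_tail (c : nat -> C) (l : C) (n : nat) :
  is_series (V := C_NormedModule) c l -> ex_series (fun k => Cmod (c k)) ->
  Cmod (sum_n c n) <= Cmod l + (Series (fun k => Cmod (c k)) - sum_n (fun k => Cmod (c k)) n).
Proof.
intros Hc Hex. set (v := fun k => Cmod (c k)) in *.
assert (Hv : forall m, sum_n v m <= Series v).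
{ apply is_lim_seq_incr_compare; [exact (Series_correct _ Hex) |].
  intros m. rewrite sum_Sn. change (sum_n v m <= sum_n v m + v (S m)).
  generalize (Cmod_ge_0 (c (S m))). unfold v. lra. }
assert (Hle : forall m, (n <= m)%nat -> Cmod (sum_n c n) <= Cmod (sum_n c m) + (sum_n v m - sum_n v n)).
{ intros m Hm. induction Hm as [| m Hm IH]; [lra |].
  rewrite !sum_Sn.
  change (Cmod (sum_n c n) <= Cmod (sum_n c m + c (S m))%C + (sum_n v m + v (S m) - sum_n v n)).
  assert (Cmod (sum_n c m) <= Cmod (sum_n c m + c (S m))%C + Cmod (c (S m))).
  { rewrite <- (Cmod_opp (c (S m))).
    replace (sum_n c m) with (sum_n c m + c (S m) + - c (S m))%C at 1.
    - apply Cmod_triangle.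
    - eq_at C. ring. }
  unfold v at 2. lra. }
apply (is_lim_seq_le_loc (fun _ => Cmod (sum_n c n))
  (fun m => Cmod (sum_n c m) + (Series v - sum_n v n)) (Cmod (sum_n c n))
  (Cmod l + (Series v - sum_n v n))).
- exists n. intros m Hm. specialize (Hle m Hm). specialize (Hv m). lra.
- apply is_lim_seq_const.
- apply is_lim_seq_plus'; [| apply is_lim_seq_const].
  apply (filterlim_comp _ _ _ _ Cmod _ (locally l)); [exact Hc |].
  exact (filterlim_norm (V := C_NormedModule) l).
Qed.

Lemma sum_n_incr (u : nat -> R) (k n : nat) :
  (forall i, 0 <= u i) -> (k <= n)%nat -> sum_n u k <= sum_n u n.
Proof.
intros Hu Hk. induction Hk as [| n Hk IH]; [lra |].
rewrite sum_Sn. change (sum_n u k <= sum_n u n + u (S n)). specialize (Hu (S n)). lra.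
Qed.

(** On the circle of radius [s = sqrt t] the weight [1 - |z|^2] is [1 - t], and Parseval produces
    [s^(2k) = t^k]. The Taylor polynomial of degree [N] is bounded there by [m / (1 - t)] plus a
    tail; [N] tends to infinity while the [n] of the left-hand side stays fixed. *)
Lemma mean_square_bound (a : nat -> C) (f : C -> C) (m t : R) (n : nat) :
  analytic_on_disc f ->
  (forall z : C, unit_disc z ->
     is_pseries (K := C_AbsRing) (V := C_NormedModule) a z (f z)) ->
  (forall z : C, unit_disc z -> Cmod (C_derive f z) * (1 - Cmod z ^ 2) <= m) ->
  0 <= t < 1 ->
  sum_n (fun k => Cmod (derive_coef a k) ^ 2 * t ^ k) n <= m ^ 2 / (1 - t) ^ 2.
Proof.
intros Hf Ha Hm Ht.
set (s := sqrt t).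
assert (Hs2 : s ^ 2 = t) by (unfold s; rewrite <- Rsqr_pow2; apply Rsqr_sqrt; lra).
assert (Hs0 : 0 <= s) by apply sqrt_pos.
assert (Hs : 0 <= s < 1) by nra.
assert (Habs : Rabs s < 1) by (rewrite Rabs_pos_eq; lra).
set (v := fun k => Cmod (derive_coef a k) * s ^ k).
assert (Hv0 : forall k, 0 <= v k).
{ intros k. apply Rmult_le_pos; [apply Cmod_ge_0 | now apply pow_le]. }
assert (Hv : ex_series v).
{ assert (HC : Rbar_lt (Rabs s) (CV_radius (PS_derive (fun n => Cmod (a n))))).
  { rewrite CV_radius_derive. now apply CV_radius_Cmod with f. }
  generalize (CV_disk_inside _ _ HC). apply ex_series_ext. intros k.
  unfold PS_derive, v, derive_coef.
  rewrite Cmod_mult, Cmod_R, !Rabs_mult, (Rabs_pos_eq (Cmod _)) by apply Cmod_ge_0.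
  rewrite (Rabs_pos_eq (s ^ k)) by now apply pow_le.
  reflexivity. }
assert (HB : forall N x, Cmod (sum_n (fun k => (derive_coef a k * s ^ k) * cis x ^ k)%C N)
  <= m / (1 - t) + (Series v - sum_n v N)).
{ intros N x.
  assert (Hd : unit_disc (s * cis x)%C) by (unfold unit_disc; rewrite Cmod_mult, Cmod_R, Cmod_cis; lra).
  assert (Hser := is_series_C_derive a f (cis x) s Ha (Cmod_cis x) Habs (Hf _ Hd)).
  assert (Hmod : forall k, Cmod (derive_coef a k * s ^ k * cis x ^ S k)%C = v k).
  { intros k. unfold v. rewrite !Cmod_mult, !Cmod_pow, Cmod_cis, Cmod_R, pow1.
    rewrite (Rabs_pos_eq s) by assumption. ring. }
  assert (Hle := Cmod_sum_n_le_tail _ _ N Hser (ex_series_ext _ _ (fun k => eq_sym (Hmod k)) Hv)).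
  cbv beta in Hle.
  rewrite (Series_ext _ _ Hmod), (sum_n_ext _ _ N Hmod) in Hle.
  (* The surplus factor [cis x] of the radial derivative has modulus 1 and is pulled out. *)
  rewrite (sum_n_ext _ (fun k => cis x * (derive_coef a k * s ^ k * cis x ^ k))%C) in Hle
    by (intros k; simpl; eq_at C; ring).
  assert (Hfac : sum_n (fun k => cis x * (derive_coef a k * s ^ k * cis x ^ k))%C N
    = (cis x * sum_n (fun k => derive_coef a k * s ^ k * cis x ^ k) N)%C).
  { exact (sum_n_mult_l (K := C_Ring) _ _ N). }
  rewrite Hfac, !Cmod_mult, Cmod_cis, !Rmult_1_l in Hle.
  eapply Rle_trans; [exact Hle |]. apply Rplus_le_compat_r.
  specialize (Hm _ Hd). rewrite Cmod_mult, Cmod_R, Cmod_cis, Rmult_1_r, (Rabs_pos_eq s), Hs2 in Hm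
    by assumption.
  apply Rmult_le_reg_r with (1 - t); [lra |].
  replace (m / (1 - t) * (1 - t)) with m by (field; lra). exact Hm. }
assert (HN : forall N, (n <= N)%nat -> sum_n (fun k => Cmod (derive_coef a k) ^ 2 * t ^ k) n
   <= (m / (1 - t) + (Series v - sum_n v N)) ^ 2).
{ intros N HnN.
  eapply Rle_trans; [apply (sum_n_incr _ n N) | ].
  - intros k. apply Rmult_le_pos; [apply pow2_ge_0 | apply pow_le; lra].
  - exact HnN.
  - eapply Rle_trans; [| apply (parseval_le (fun k => derive_coef a k * s ^ k)%C N _ (HB N))].
    right. apply sum_n_ext. intros k.
    rewrite Cmod_mult, Cmod_pow, Cmod_R, (Rabs_pos_eq s) by assumption.
    rewrite <- Hs2, <- pow_mult, Rpow_mult_distr, <- pow_mult, (Nat.mul_comm 2). reflexivity. }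
apply (is_lim_seq_le_loc (fun _ => sum_n (fun k => Cmod (derive_coef a k) ^ 2 * t ^ k) n)
  (fun N => (m / (1 - t) + (Series v - sum_n v N)) ^ 2)
  (sum_n (fun k => Cmod (derive_coef a k) ^ 2 * t ^ k) n) (m ^ 2 / (1 - t) ^ 2)).
- exists n. exact HN.
- apply is_lim_seq_const.
- replace (m ^ 2 / (1 - t) ^ 2) with ((m / (1 - t) + (Series v - Series v)) ^ 2) by (field; lra).
  apply (is_lim_seq_continuous (fun x => x ^ 2)).
  + apply derivable_continuous_pt, derivable_pt_pow.
  + apply is_lim_seq_plus'; [apply is_lim_seq_const |].
    apply is_lim_seq_minus'; [apply is_lim_seq_const |].
    exact (Series_correct _ Hv).
Qed.

(** * The radius *)

Lemma sum_n_le_Series (u : nat -> R) (n : nat) :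
  (forall i, 0 <= u i) -> ex_series u -> sum_n u n <= Series u.
Proof.
intros Hu Hex. apply (is_lim_seq_incr_compare (sum_n u)); [exact (Series_correct _ Hex) |].
intros m. apply sum_n_incr; [exact Hu | lia].
Qed.

Lemma series_nonneg_bounded (u : nat -> R) (B : R) :
  (forall i, 0 <= u i) -> (forall n, sum_n u n <= B) -> ex_series u /\ Series u <= B.
Proof.
intros Hu HB.
assert (Hex : ex_series u).
{ destruct (ex_finite_lim_seq_incr (sum_n u) B) as [x Hx].
  - intros n. apply sum_n_incr; [exact Hu | lia].
  - exact HB.
  - exists x. exact Hx. }
split; [exact Hex |].
apply (is_lim_seq_le (sum_n u) (fun _ => B) (Series u) B HB).
- exact (Series_correct _ Hex).
- apply is_lim_seq_const.
Qed.

Lemma pochhammer_S_l (q : R) (n : nat) : pochhammer q (S n) = q * pochhammer (q + 1) n.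
Proof.
induction n as [| n IH]; [simpl; ring |].
change (pochhammer q (S (S n))) with (pochhammer q (S n) * (q + INR (S n))).
rewrite IH, S_INR. simpl. ring.
Qed.

(** With [b = 1 - alpha], the identity [(b)_(k+1) = b (b+1)_k] trades the parameter [2 - alpha] for
    the factor [b]. *)
Lemma hyp2F1_11_coef (alpha : R) (k : nat) : alpha < 1 ->
  pochhammer 1 k * pochhammer 1 k / pochhammer (2 - alpha) k / INR (fact k)
  = (1 - alpha) * beta_moment (1 - alpha) k.
Proof.
intros Ha. unfold beta_moment.
rewrite pochhammer_S_l, pochhammer_1.
replace (1 - alpha + 1) with (2 - alpha) by ring.
assert (0 < pochhammer (2 - alpha) k) by (apply pochhammer_pos; lra).
assert (0 < INR (fact k)) by apply lt_0_INR, lt_O_fact.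
field. lra.
Qed.

Lemma pochhammer_2 (n : nat) : pochhammer 2 n = INR (S n) * INR (fact n).
Proof.
rewrite <- mult_INR, <- fact_simpl, <- pochhammer_1, pochhammer_S_l.
rewrite Rmult_1_l. reflexivity.
Qed.

Lemma hyp2F1_21_coef (alpha : R) (k : nat) : alpha < 1 ->
  pochhammer 2 k * pochhammer 1 k / pochhammer (2 - alpha) k / INR (fact k)
  = (1 - alpha) * (INR (S k) * beta_moment (1 - alpha) k).
Proof.
intros Ha. unfold beta_moment.
rewrite pochhammer_S_l, pochhammer_1, pochhammer_2.
replace (1 - alpha + 1) with (2 - alpha) by ring.
assert (0 < pochhammer (2 - alpha) k) by (apply pochhammer_pos; lra).
assert (0 < INR (fact k)) by apply lt_0_INR, lt_O_fact.
field. lra.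
Qed.

Lemma hyp2F1_11 (alpha x : R) : alpha < 1 ->
  hyp2F1 1 1 (2 - alpha) x = PSeries (fun k => (1 - alpha) * beta_moment (1 - alpha) k) x.
Proof. intros Ha. apply PSeries_ext. intros k. now apply hyp2F1_11_coef. Qed.

Lemma hyp2F1_21 (alpha x : R) : alpha < 1 ->
  hyp2F1 2 1 (2 - alpha) x
  = PSeries (fun k => (1 - alpha) * (INR (S k) * beta_moment (1 - alpha) k)) x.
Proof. intros Ha. apply PSeries_ext. intros k. now apply hyp2F1_21_coef. Qed.

(** The sequence starts at 1 and its successive ratios [(k+2)/(k+1+b)] are at least 1. Thus the
    second hypergeometric series dominates the geometric one. *)
Lemma beta_moment_lower (b : R) (k : nat) : 0 < b < 1 ->
  1 <= b * (INR (S k) * beta_moment b k).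
Proof.
intros Hb. induction k as [| k IH].
- rewrite beta_moment_0 by lra. simpl. right. field. lra.
- rewrite beta_moment_S by lra.
  assert (HS : 0 < INR (S k)) by apply lt_0_INR, Nat.lt_0_succ.
  apply Rle_trans with (1 := IH).
  rewrite (S_INR (S k)).
  apply Rmult_le_compat_l; [lra |].
  assert (Hm := beta_moment_pos b k ltac:(lra)).
  replace ((INR (S k) + 1) * (INR (S k) * beta_moment b k / (INR (S k) + b)))
    with (INR (S k) * beta_moment b k * ((INR (S k) + 1) / (INR (S k) + b))) by (field; lra).
  rewrite <- (Rmult_1_r (INR (S k) * beta_moment b k)) at 1.
  apply Rmult_le_compat_l; [nra |].
  apply Rmult_le_reg_r with (INR (S k) + b); [lra |].
  replace ((INR (S k) + 1) / (INR (S k) + b) * (INR (S k) + b)) with (INR (S k) + 1) by (field; lra).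
  lra.
Qed.

Lemma beta_moment_upper (b : R) (k : nat) : 0 < b < 1 -> b * beta_moment b k <= 1.
Proof.
intros Hb. induction k as [| k IH].
- rewrite beta_moment_0 by lra. right. field. lra.
- rewrite beta_moment_S by lra.
  assert (HS : 0 < INR (S k)) by apply lt_0_INR, Nat.lt_0_succ.
  assert (Hm := beta_moment_pos b k ltac:(lra)).
  apply Rmult_le_reg_r with (INR (S k) + b); [lra |].
  replace (b * (INR (S k) * beta_moment b k / (INR (S k) + b)) * (INR (S k) + b))
    with (b * beta_moment b k * INR (S k)) by (field; lra).
  nra.
Qed.

(** The numbers [k + 1] are the coefficients of the differentiated geometric series, whose radius is
    that of the geometric series. Both hypergeometric series obey this bound, by
    [beta_coef_bounds]. *)
Lemma CV_radius_linear (x : nat -> R) (t : R) :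
  (forall k, 0 <= x k <= INR (S k)) -> Rabs t < 1 -> Rbar_lt (Rabs t) (CV_radius x).
Proof.
intros Hx Ht.
apply Rbar_lt_le_trans with (CV_radius (PS_derive (fun _ => 1))).
- rewrite CV_radius_derive. apply CV_radius_ge_1; [| exact Ht].
  intros r Hr. exists 1. intros n. rewrite Rmult_1_l, Rabs_pos_eq by (apply pow_le; lra).
  rewrite <- (pow1 n). apply pow_incr. lra.
- apply CV_radius_dominated. intros n. unfold PS_derive.
  rewrite Rabs_pos_eq by apply Hx. rewrite Rmult_1_r. apply Hx.
Qed.

Lemma PSeries_term_nonneg (x : nat -> R) (t : R) (k : nat) :
  (forall k, 0 <= x k) -> 0 <= t -> 0 <= x k * t ^ k.
Proof. intros Hx Ht. apply Rmult_le_pos; [apply Hx | now apply pow_le]. Qed.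

Lemma ex_PSeries_linear (x : nat -> R) (t : R) :
  (forall k, 0 <= x k <= INR (S k)) -> 0 <= t < 1 -> ex_series (fun k => x k * t ^ k).
Proof.
intros Hx Ht.
assert (HC : Rbar_lt (Rabs t) (CV_radius x)) by (apply CV_radius_linear; rewrite ?Rabs_pos_eq; auto; lra).
generalize (CV_disk_inside _ _ HC). apply ex_series_ext.
intros n. rewrite Rabs_pos_eq; [reflexivity |]. apply PSeries_term_nonneg; [apply Hx | lra].
Qed.

Lemma PSeries_incr (x : nat -> R) (s t : R) :
  (forall k, 0 <= x k <= INR (S k)) -> 0 <= s <= t -> t < 1 -> PSeries x s <= PSeries x t.
Proof.
intros Hx Hst Ht. apply Series_le; [| apply ex_PSeries_linear; [exact Hx | lra]].
intros n. split; [apply PSeries_term_nonneg; [apply Hx | lra] |].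
apply Rmult_le_compat_l; [apply Hx | apply pow_incr; lra].
Qed.

Lemma PSeries_partial (x : nat -> R) (t : R) (n : nat) :
  (forall k, 0 <= x k <= INR (S k)) -> 0 <= t < 1 ->
  sum_n (fun k => x k * t ^ k) n <= PSeries x t.
Proof.
intros Hx Ht. apply sum_n_le_Series; [| now apply ex_PSeries_linear].
intros k. apply PSeries_term_nonneg; [apply Hx | lra].
Qed.

Lemma beta_coef_bounds (b : R) (k : nat) : 0 < b < 1 ->
  0 <= b * beta_moment b k <= INR (S k) /\
  0 <= b * (INR (S k) * beta_moment b k) <= INR (S k).
Proof.
intros Hb.
assert (Hm := beta_moment_pos b k ltac:(lra)).
assert (Hu := beta_moment_upper b k Hb).
assert (HS : 1 <= INR (S k)) by (rewrite S_INR; generalize (pos_INR k); lra).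
assert (Hp : 0 < b * beta_moment b k) by (apply Rmult_lt_0_compat; lra).
replace (b * (INR (S k) * beta_moment b k)) with (INR (S k) * (b * beta_moment b k)) by ring.
repeat split; nra.
Qed.

(** Multiplying the radius equation by [r^2] removes the pole at 0, so the intermediate value
    theorem can start from [r = 0]. *)
Definition radius_fun (alpha r : R) : R :=
  r ^ 2 * (hyp2F1 1 1 (2 - alpha) r * hyp2F1 2 1 (2 - alpha) r).

Lemma hyp2F1_ge_1 (alpha r : R) : 0 < alpha < 1 -> 0 <= r < 1 ->
  1 <= hyp2F1 1 1 (2 - alpha) r /\ 1 <= hyp2F1 2 1 (2 - alpha) r.
Proof.
intros Ha Hr. rewrite hyp2F1_11, hyp2F1_21 by lra.
split.
- eapply Rle_trans; [| apply (PSeries_partial _ r 0); [intros k; apply beta_coef_bounds; lra | exact Hr]].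
  rewrite sum_O, beta_moment_0 by lra. right. simpl. field. lra.
- eapply Rle_trans; [| apply (PSeries_partial _ r 0); [intros k; apply beta_coef_bounds; lra | exact Hr]].
  rewrite sum_O, beta_moment_0 by lra. right. simpl. field. lra.
Qed.

(** Strictness comes from [r^2] alone: the two series are nondecreasing and at least 1. It makes the
    root of the radius equation unique. *)
Lemma radius_fun_lt (alpha s t : R) : 0 < alpha < 1 -> 0 <= s < t -> t < 1 ->
  radius_fun alpha s < radius_fun alpha t.
Proof.
intros Ha Hst Ht.
destruct (hyp2F1_ge_1 alpha s Ha ltac:(lra)) as [H1 H2].
assert (H3 : hyp2F1 1 1 (2 - alpha) s <= hyp2F1 1 1 (2 - alpha) t).
{ rewrite !hyp2F1_11 by lra. apply PSeries_incr; [intros k; apply beta_coef_bounds; lra | lra | lra]. }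
assert (H4 : hyp2F1 2 1 (2 - alpha) s <= hyp2F1 2 1 (2 - alpha) t).
{ rewrite !hyp2F1_21 by lra. apply PSeries_incr; [intros k; apply beta_coef_bounds; lra | lra | lra]. }
unfold radius_fun.
assert (H5 : hyp2F1 1 1 (2 - alpha) s * hyp2F1 2 1 (2 - alpha) s
  <= hyp2F1 1 1 (2 - alpha) t * hyp2F1 2 1 (2 - alpha) t) by (apply Rmult_le_compat; lra).
assert (H6 : 1 <= hyp2F1 1 1 (2 - alpha) s * hyp2F1 2 1 (2 - alpha) s) by nra.
assert (s ^ 2 < t ^ 2) by nra.
assert (0 <= s ^ 2) by apply pow2_ge_0.
nra.
Qed.

Lemma radius_fun_continuous (alpha r : R) : 0 < alpha < 1 -> 0 <= r < 1 ->
  continuity_pt (radius_fun alpha) r.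
Proof.
intros Ha Hr.
assert (Habs : Rabs r < 1) by (rewrite Rabs_pos_eq; lra).
apply (continuity_pt_mult (fun r => r ^ 2)).
{ apply derivable_continuous_pt, derivable_pt_pow. }
apply continuity_pt_mult; apply PSeries_continuity.
- rewrite (CV_radius_ext _ (fun k => (1 - alpha) * beta_moment (1 - alpha) k)).
  + apply CV_radius_linear; [intros k; apply beta_coef_bounds; lra | exact Habs].
  + intros k. apply hyp2F1_11_coef; lra.
- rewrite (CV_radius_ext _ (fun k => (1 - alpha) * (INR (S k) * beta_moment (1 - alpha) k))).
  + apply CV_radius_linear; [intros k; apply beta_coef_bounds; lra | exact Habs].
  + intros k. apply hyp2F1_21_coef; lra.
Qed.

Lemma radius_equation_iff (alpha r : R) : 0 < r ->
  radius_equation alpha r <-> radius_fun alpha r = (1 - alpha) ^ 2.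
Proof.
intros Hr. unfold radius_equation, radius_fun. split; intros H.
- rewrite H. field. lra.
- rewrite <- H. field. lra.
Qed.

Lemma exists_min_radius (alpha : R) : 0 < alpha < 1 ->
  exists M, is_min_radius alpha M /\
    forall r, 0 < r <= M -> radius_fun alpha r <= (1 - alpha) ^ 2.
Proof.
intros Ha.
(* At [3/4] the second series is at least the geometric sum 4 and the first at least 1, so
   [radius_fun] is at least [9/4], beyond [(1 - alpha)^2 < 1]. *)
destruct (IVT_interv (fun r => radius_fun alpha r - (1 - alpha) ^ 2) 0 (3 / 4)) as [M [HM HM0]].
- intros r Hr. apply continuity_pt_minus.
  + apply radius_fun_continuous; lra.
  + apply continuity_pt_const. easy.
- lra.
- unfold radius_fun. simpl. nra.
- assert (H1 := proj1 (hyp2F1_ge_1 alpha (3 / 4) Ha ltac:(lra))).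
  assert (H2 : 4 <= hyp2F1 2 1 (2 - alpha) (3 / 4)).
  { rewrite hyp2F1_21 by lra.
    apply Rle_trans with (Series (fun k => (3 / 4) ^ k)).
    { rewrite Series_geom by (rewrite Rabs_pos_eq; lra). lra. }
    apply Series_le.
    - intros k. split; [apply pow_le; lra |].
      rewrite <- (Rmult_1_l ((3 / 4) ^ k)) at 1.
      apply Rmult_le_compat_r; [apply pow_le; lra | apply beta_moment_lower; lra].
    - apply ex_PSeries_linear; [intros k; apply beta_coef_bounds; lra | lra]. }
  unfold radius_fun. nra.
- assert (HM' : radius_fun alpha M = (1 - alpha) ^ 2) by lra.
  assert (M <> 0).
  { intros ->. unfold radius_fun in HM'. simpl in HM'. nra. }
  exists M. split; [split; [split; [lra |] |] |].
  + apply radius_equation_iff; [lra | exact HM'].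
  + intros s Hs Heq. apply radius_equation_iff in Heq; [| lra].
    apply Rnot_lt_le. intros Hlt.
    generalize (radius_fun_lt alpha s M Ha ltac:(lra) ltac:(lra)). lra.
  + intros r [Hr [Hlt | ->]]; [| lra].
    generalize (radius_fun_lt alpha r M Ha ltac:(lra) ltac:(lra)). lra.
Qed.

(** * The Bohr sum *)

Lemma sum_n_linear_pow (t : R) (n : nat) :
  (1 - t) ^ 2 * sum_n (fun k => INR (S k) * t ^ k) n
  = 1 - t ^ S n * (INR (n + 2) - INR (S n) * t).
Proof.
induction n as [| n IH].
- rewrite sum_O. simpl. ring.
- rewrite sum_Sn. change (plus ?x ?y) with (x + y).
  rewrite Rmult_plus_distr_l, IH, !plus_INR, !S_INR. simpl. ring.
Qed.

(** The remainder bound does not depend on [t], so it can serve as the constant [T] of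
    [beta_functional_nonneg]. *)
Lemma linear_pow_tail (r t : R) (n : nat) : 0 <= t <= r -> r < 1 ->
  / (1 - t) ^ 2 <= sum_n (fun k => INR (S k) * t ^ k) n + INR (n + 2) * r ^ S n / (1 - r) ^ 2.
Proof.
intros Ht Hr.
assert (Ht1 : 0 < (1 - t) ^ 2) by (apply pow_lt; lra).
assert (Hr1 : 0 < (1 - r) ^ 2) by (apply pow_lt; lra).
assert (Heq := sum_n_linear_pow t n).
assert (Hp : 0 <= t ^ S n <= r ^ S n) by (split; [apply pow_le; lra | apply pow_incr; lra]).
assert (HS := pos_INR (S n)).
assert (HS2 := pos_INR (n + 2)).
apply Rle_trans with (sum_n (fun k => INR (S k) * t ^ k) n + INR (n + 2) * r ^ S n / (1 - t) ^ 2).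
- apply Rmult_le_reg_l with ((1 - t) ^ 2); [exact Ht1 |].
  rewrite Rmult_plus_distr_l, Heq, Rinv_r by lra.
  replace ((1 - t) ^ 2 * (INR (n + 2) * r ^ S n / (1 - t) ^ 2)) with (INR (n + 2) * r ^ S n) by (field; lra).
  assert (0 <= t ^ S n * (INR (S n) * t)) by (apply Rmult_le_pos; [| apply Rmult_le_pos]; lra).
  assert (INR (n + 2) * t ^ S n <= INR (n + 2) * r ^ S n) by (apply Rmult_le_compat_l; lra).
  lra.
- apply Rplus_le_compat_l, Rmult_le_compat_l.
  + apply Rmult_le_pos; lra.
  + apply Rinv_le_contravar; [exact Hr1 |]. apply pow_incr. lra.
Qed.

Lemma linear_pow_tail_lim (r : R) : 0 <= r < 1 ->
  is_lim_seq (fun n => INR (n + 2) * r ^ S n) 0.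
Proof.
intros Hr.
assert (H := ex_series_lim_0 _ (ex_PSeries_linear (fun k => INR (S k)) r
  (fun k => conj (pos_INR _) (Rle_refl _)) Hr)).
apply is_lim_seq_incr_1 in H. revert H. apply is_lim_seq_ext.
intros n. f_equal. f_equal. lia.
Qed.

(** The majorant [m^2 / (1-t)^2] is not a polynomial, so at [t = r u] it is replaced by its Taylor
    polynomial of degree [N] plus a constant error. The moments turn that error into a multiple of
    [tail N], which tends to 0. *)
Lemma weighted_square_bound (B : nat -> R) (m b r : R) (n : nat) :
  (forall k, 0 <= B k) -> 0 < b < 1 -> 0 < r < 1 ->
  (forall t N, 0 <= t < 1 -> sum_n (fun k => B k * t ^ k) N <= m ^ 2 / (1 - t) ^ 2) ->
  sum_n (fun k => B k * r ^ k * beta_moment b k) n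
  <= m ^ 2 / b * PSeries (fun k => b * (INR (S k) * beta_moment b k)) r.
Proof.
intros HB0 Hb Hr HB.
set (x := fun k => b * (INR (S k) * beta_moment b k)).
assert (Hx : forall k, 0 <= x k <= INR (S k)) by (intros k; now apply beta_coef_bounds).
set (tail := fun N => INR (N + 2) * r ^ S N).
assert (HN : forall N, (n <= N)%nat -> sum_n (fun k => B k * r ^ k * beta_moment b k) n
  <= m ^ 2 / b * PSeries x r + m ^ 2 / (1 - r) ^ 2 / b * tail N).
{ intros N HnN.
  assert (Hpos : 0 <= sum_n (fun k => (m ^ 2 * (INR (S k) * r ^ k) - B k * r ^ k) * beta_moment b k) N
     + m ^ 2 / (1 - r) ^ 2 * tail N / b).
  { apply beta_functional_nonneg; [lra |]. intros u Hu.
    assert (Hru : 0 <= r * u <= r) by nra.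
    rewrite (sum_n_ext _ (fun k => m ^ 2 * (INR (S k) * (r * u) ^ k) + (- 1) * (B k * (r * u) ^ k))).
    2: { intros k. rewrite Rpow_mult_distr.
         eq_at R. ring. }
    change (fun k => m ^ 2 * (INR (S k) * (r * u) ^ k) + (- 1) * (B k * (r * u) ^ k))
      with (fun k => plus (m ^ 2 * (INR (S k) * (r * u) ^ k)) ((- 1) * (B k * (r * u) ^ k))).
    rewrite sum_n_plus, !sum_n_Rmult_l.
    change (plus ?x ?y) with (x + y).
    assert (H1 := linear_pow_tail r (r * u) N Hru ltac:(lra)).
    assert (H2 := HB (r * u) N ltac:(lra)).
    apply Rmult_le_compat_l with (r := m ^ 2) in H1; [| apply pow2_ge_0].
    unfold tail.
    replace (m ^ 2 / (1 - r) ^ 2 * (INR (N + 2) * r ^ S N))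
      with (m ^ 2 * (INR (N + 2) * r ^ S N / (1 - r) ^ 2)) by (field; lra).
    unfold Rdiv at 1 in H2. lra. }
  rewrite (sum_n_ext _ (fun k => m ^ 2 / b * (x k * r ^ k) + (- 1) * (B k * r ^ k * beta_moment b k))) in Hpos.
  2: { intros k. unfold x. eq_at R. field. lra. }
  change (fun k => m ^ 2 / b * (x k * r ^ k) + (- 1) * (B k * r ^ k * beta_moment b k))
    with (fun k => plus (m ^ 2 / b * (x k * r ^ k)) ((- 1) * (B k * r ^ k * beta_moment b k))) in Hpos.
  rewrite sum_n_plus, !sum_n_Rmult_l in Hpos.
  change (plus ?x ?y) with (x + y) in Hpos.
  assert (Hle : sum_n (fun k => B k * r ^ k * beta_moment b k) n
    <= sum_n (fun k => B k * r ^ k * beta_moment b k) N).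
  { apply sum_n_incr; [| exact HnN]. intros k.
    apply Rmult_le_pos; [apply Rmult_le_pos; [apply HB0 | apply pow_le; lra] |].
    left. apply beta_moment_pos. lra. }
  assert (Hpart : m ^ 2 / b * sum_n (fun k => x k * r ^ k) N <= m ^ 2 / b * PSeries x r).
  { apply Rmult_le_compat_l; [| apply PSeries_partial; [exact Hx | lra]].
    apply Rmult_le_pos; [apply pow2_ge_0 | left; apply Rinv_0_lt_compat; lra]. }
  replace (m ^ 2 / (1 - r) ^ 2 / b * tail N) with (m ^ 2 / (1 - r) ^ 2 * tail N / b) by (field; lra).
  lra. }
set (X := sum_n _ n) in *.
apply (is_lim_seq_le_loc (fun _ => X)
  (fun N => m ^ 2 / b * PSeries x r + m ^ 2 / (1 - r) ^ 2 / b * tail N) X (m ^ 2 / b * PSeries x r)).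
- exists n. exact HN.
- apply is_lim_seq_const.
- generalize (m ^ 2 / b * PSeries x r). intros A.
  replace (Finite A) with (Finite (A + 0)) by (f_equal; ring).
  apply is_lim_seq_plus'; [apply is_lim_seq_const |].
  rewrite <- (Rmult_0_r (m ^ 2 / (1 - r) ^ 2 / b)).
  apply (is_lim_seq_scal_l tail (m ^ 2 / (1 - r) ^ 2 / b) 0).
  apply linear_pow_tail_lim. lra.
Qed.

Lemma weighted_Cauchy_Schwarz (w v : nat -> R) (n : nat) : (forall k, 0 <= w k) ->
  (sum_n (fun k => w k * v k) n) ^ 2 <= sum_n w n * sum_n (fun k => w k * v k ^ 2) n.
Proof.
intros Hw.
induction n as [| n IH].
- rewrite !sum_O. right. ring.
- rewrite !sum_Sn. repeat change (plus ?x ?y) with (x + y).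
  set (S1 := sum_n (fun k => w k * v k) n) in *.
  set (S0 := sum_n w n) in *.
  set (S2 := sum_n (fun k => w k * v k ^ 2) n) in *.
  (* This quantity is the sum of the [w k * (v (S n) - v k)^2]. Multiplied by [w (S n)], it is
     exactly what the new term adds to the gap between the two sides. *)
  assert (H0 : 0 <= S0 * v (S n) ^ 2 - 2 * S1 * v (S n) + S2).
  { unfold S0, S1, S2.
    replace (_ + _) with (sum_n (fun k => w k * (v (S n) - v k) ^ 2) n).
    - apply Rle_trans with (w 0%nat * (v (S n) - v 0%nat) ^ 2).
      + apply Rmult_le_pos; [apply Hw | apply pow2_ge_0].
      + rewrite <- (sum_O (fun k => w k * (v (S n) - v k) ^ 2)).
        apply sum_n_incr; [| lia]. intros k. apply Rmult_le_pos; [apply Hw | apply pow2_ge_0].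
    - rewrite (sum_n_ext _ (fun k => plus (w k * v (S n) ^ 2)
        (plus ((- 2 * v (S n)) * (w k * v k)) (w k * v k ^ 2)))).
      + rewrite !sum_n_plus, sum_n_Rmult_r, sum_n_Rmult_l.
        repeat change (plus ?x ?y) with (x + y).
        eq_at R. ring.
      + intros k. repeat change (plus ?x ?y) with (x + y).
        eq_at R. ring. }
  assert (Hwn := Hw (S n)).
  assert (0 <= w (S n) * (S0 * v (S n) ^ 2 - 2 * S1 * v (S n) + S2)) by now apply Rmult_le_pos.
  nra.
Qed.

Lemma Bloch_norm_bounds (f : C -> C) (z : C) :
  Rbar_le (Bloch_norm f) (Finite 1) -> unit_disc z ->
  Cmod (C_derive f z) * (1 - Cmod z ^ 2) <= 1 - Cmod (f (RtoC 0)).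
Proof.
intros Hn Hz.
set (y := Cmod (C_derive f z) * (1 - Cmod z ^ 2)).
assert (Hy : Rbar_le y (Bloch_seminorm f)).
{ apply (proj1 (Lub_Rbar_correct _)). now exists z. }
(* The norm bound excludes [p_infty], and [Hy] excludes [m_infty]. *)
unfold Bloch_norm in Hn. destruct (Bloch_seminorm f) as [s | |]; simpl in *; [lra | easy | easy].
Qed.

Lemma bohr_partial_sum (f : C -> C) (a : nat -> C) (alpha r : R) (n : nat) :
  0 < alpha < 1 -> 0 < r < 1 -> radius_fun alpha r <= (1 - alpha) ^ 2 ->
  analytic_on_disc f ->
  Rbar_le (Bloch_norm f) (Finite 1) ->
  (forall z : C, unit_disc z ->
     is_pseries (K := C_AbsRing) (V := C_NormedModule) a z (f z)) ->
  r * sum_n (fun k => beta_moment (1 - alpha) k * r ^ k * Cmod (derive_coef a k)) n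
  <= 1 - Cmod (f (RtoC 0)).
Proof.
intros Ha Hr Hrad Hf Hn Hp.
set (m := 1 - Cmod (f (RtoC 0))).
set (b := 1 - alpha).
assert (Hm : forall z, unit_disc z -> Cmod (C_derive f z) * (1 - Cmod z ^ 2) <= m).
{ intros z Hz. now apply Bloch_norm_bounds. }
assert (Hm0 : 0 <= m).
{ assert (Hd : unit_disc (RtoC 0)) by (unfold unit_disc; rewrite Cmod_0; lra).
  eapply Rle_trans; [| apply (Hm _ Hd)].
  apply Rmult_le_pos; [apply Cmod_ge_0 | rewrite Cmod_0; lra]. }
set (w := fun k => beta_moment b k * r ^ k).
assert (Hw : forall k, 0 <= w k).
{ intros k. apply Rmult_le_pos; [left; apply beta_moment_pos; unfold b; lra | apply pow_le; lra]. }
assert (HCS := weighted_Cauchy_Schwarz w (fun k => Cmod (derive_coef a k)) n Hw).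
assert (H2 : sum_n (fun k => w k * Cmod (derive_coef a k) ^ 2) n
  <= m ^ 2 / b * hyp2F1 2 1 (2 - alpha) r).
{ rewrite hyp2F1_21 by lra. fold b.
  rewrite (sum_n_ext _ (fun k => Cmod (derive_coef a k) ^ 2 * r ^ k * beta_moment b k)).
  - apply (weighted_square_bound (fun k => Cmod (derive_coef a k) ^ 2)).
    + intros k. apply pow2_ge_0.
    + unfold b; lra.
    + exact Hr.
    + intros t N Ht. now apply mean_square_bound with f.
  - intros k. unfold w. eq_at R. ring. }
assert (H1 : sum_n w n <= / b * hyp2F1 1 1 (2 - alpha) r).
{ rewrite hyp2F1_11 by lra. fold b.
  rewrite (sum_n_ext _ (fun k => / b * (b * beta_moment b k * r ^ k))).
  - rewrite sum_n_Rmult_l. apply Rmult_le_compat_l.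
    + left. apply Rinv_0_lt_compat. unfold b; lra.
    + apply PSeries_partial; [intros k; apply beta_coef_bounds; unfold b; lra | lra].
  - intros k. unfold w. eq_at R.
    field. unfold b; lra. }
set (F1 := hyp2F1 1 1 (2 - alpha) r) in *. set (F2 := hyp2F1 2 1 (2 - alpha) r) in *.
set (T := sum_n (fun k => w k * Cmod (derive_coef a k)) n) in *.
change (r * T <= m).
(* Squares replace the square root: [m < r T] with [0 <= m] contradicts [(r T)^2 <= m^2]. *)
apply Rnot_lt_le. intros Hlt.
assert (Hb : 0 < b) by (unfold b; lra).
assert (HT : T ^ 2 <= / b * F1 * (m ^ 2 / b * F2)).
{ eapply Rle_trans; [exact HCS |]. apply Rmult_le_compat; [| | exact H1 | exact H2].
  - eapply Rle_trans; [apply (Hw 0%nat) |]. rewrite <- (sum_O w). apply sum_n_incr; [exact Hw | lia].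
  - eapply Rle_trans with (w 0%nat * Cmod (derive_coef a 0%nat) ^ 2).
    + apply Rmult_le_pos; [apply Hw | apply pow2_ge_0].
    + rewrite <- (sum_O (fun k => w k * Cmod (derive_coef a k) ^ 2)).
      apply sum_n_incr; [| lia]. intros k. apply Rmult_le_pos; [apply Hw | apply pow2_ge_0]. }
assert (Hfin : (r * T) ^ 2 <= m ^ 2).
{ apply Rle_trans with (m ^ 2 * (radius_fun alpha r / b ^ 2)).
  - apply Rmult_le_compat_l with (r := r ^ 2) in HT; [| apply pow2_ge_0].
    rewrite Rpow_mult_distr. eapply Rle_trans; [exact HT |].
    unfold radius_fun. fold F1 F2. right. field. lra.
  - rewrite <- (Rmult_1_r (m ^ 2)) at 2. apply Rmult_le_compat_l; [apply pow2_ge_0 |].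
    assert (0 < b ^ 2) by now apply pow_lt.
    apply Rmult_le_reg_r with (b ^ 2); [assumption |].
    replace (radius_fun alpha r / b ^ 2 * b ^ 2) with (radius_fun alpha r) by (field; lra).
    rewrite Rmult_1_l. exact Hrad. }
nra.
Qed.

Theorem theorem3p12 (alpha : R) (halpha : 0 < alpha < 1) :
  exists M : R, is_min_radius alpha M /\
    forall (f : C -> C) (a : nat -> C),
      is_Bloch f ->
      Rbar_le (Bloch_norm f) (Finite 1) ->
      (forall z : C, unit_disc z ->
         is_pseries (K := C_AbsRing) (V := C_NormedModule) a z (f z)) ->
      forall r : R, 0 < r <= M ->
        ex_series (frac_bohr_term alpha a r) /\
        Series (frac_bohr_term alpha a r)
          <= Rpower r (- alpha) / Gamma (1 - alpha).
Proof.
destruct (exists_min_radius alpha halpha) as [M [HM Hrad]].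
exists M. split; [exact HM |].
intros f a [Hf _] Hn Hp r Hr.
assert (Hr1 : 0 < r < 1) by (destruct HM as [[HM1 _] _]; lra).
specialize (Hrad r Hr).
set (kappa := Rpower r (- alpha) / Gamma (1 - alpha)).
assert (HG : 0 < Gamma (1 - alpha)) by (apply (Gamma_add_nat (1 - alpha) 0); lra).
assert (Hk : 0 < kappa) by (apply Rdiv_lt_0_compat; [apply exp_pos | exact HG]).
set (c := fun n => INR (fact n) / pochhammer (1 - alpha) n).
assert (Hc : forall n, 0 < c n).
{ intros n. apply Rdiv_lt_0_compat; [apply lt_0_INR, lt_O_fact | apply pochhammer_pos; lra]. }
assert (Hterm : forall n, frac_bohr_term alpha a r n = kappa * (c n * Cmod (a n) * r ^ n)).
{ intros n. unfold frac_bohr_term. rewrite Gamma_ratio by exact halpha. fold (c n).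
  unfold Rminus at 2. rewrite Rpower_plus, Rpower_pow by lra. unfold kappa. field. lra. }
assert (Ha0 : f (RtoC 0) = a 0%nat).
{ assert (Hd : unit_disc (RtoC 0)) by (unfold unit_disc; rewrite Cmod_0; lra).
  apply (filterlim_locally_unique (K := C_AbsRing) (V := C_NormedModule) _ _ _ (Hp _ Hd)).
  exact (is_pseries_0 (K := C_AbsRing) (V := C_NormedModule) a). }
apply series_nonneg_bounded.
- intros n. rewrite Hterm. apply Rmult_le_pos; [lra |].
  apply Rmult_le_pos; [apply Rmult_le_pos |].
  + left. apply Hc.
  + apply Cmod_ge_0.
  + apply pow_le. lra.
- intros n. rewrite (sum_n_ext _ _ n Hterm), sum_n_Rmult_l.
  rewrite <- (Rmult_1_r kappa) at 2. apply Rmult_le_compat_l; [lra |].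
  set (u := fun k => c k * Cmod (a k) * r ^ k).
  (* One more term is added so that, after splitting off index 0, exactly the shifted indices 0 to
     [n] remain, also when [n = 0]. *)
  apply Rle_trans with (sum_n u (S n)).
  { apply sum_n_incr; [| lia]. intros k. apply Rmult_le_pos; [apply Rmult_le_pos |].
    - left. apply Hc.
    - apply Cmod_ge_0.
    - apply pow_le. lra. }
  assert (Hshift : sum_n u (S n) = u 0%nat + sum_n (fun k => u (S k)) n).
  { unfold sum_n. rewrite sum_Sn_m by lia. rewrite sum_n_m_S. reflexivity. }
  rewrite Hshift.
  assert (Hu0 : u 0%nat = Cmod (f (RtoC 0))).
  { rewrite Ha0. unfold u, c.
    change (INR (fact 0)) with 1. change (pochhammer (1 - alpha) 0) with 1.
    rewrite pow_O. field. }
  rewrite Hu0.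
  (* Here [c (S k)] is [(k+1)] times [beta_moment (1 - alpha) k]; the factor [k + 1] passes into
     [derive_coef], and one power of [r] is set apart. *)
  rewrite (sum_n_ext _ (fun k => r * (beta_moment (1 - alpha) k * r ^ k * Cmod (derive_coef a k)))).
  + rewrite sum_n_Rmult_l.
    assert (H := bohr_partial_sum f a alpha r n halpha Hr1 Hrad Hf Hn Hp). lra.
  + intros k. unfold u, c, beta_moment, derive_coef.
    rewrite Cmod_mult, Cmod_R, Rabs_pos_eq by apply pos_INR.
    rewrite fact_simpl, mult_INR. simpl (r ^ S k).
    eq_at R.
    unfold Rdiv. ring.
Qed.
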